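(* Let $p_1\equiv p_2\equiv1\pmod4$ be primes, $k=\mathbb{Q}(\sqrt{2p_1p_2},i)$, $k^{( * )}=\mathbb{Q}(\sqrt2,\sqrt{p_1},\sqrt{p_2},i)$ its absolute genus field, $Q$ the unit index $q(\mathbb{Q}(\sqrt2,\sqrt{p_1p_2})/\mathbb{Q})$, and $\varepsilon_3$ the fundamental unit of $\mathbb{Q}(\sqrt{2p_1p_2})$. (1) If $N(\varepsilon_3)=-1$, then $Am_s(k/\mathbb{Q}(i))=\langle[\mathcal{H}_0],[\mathcal{H}_1],[\mathcal{H}_2]\rangle\subseteq\ker J_{k^{( * )}}$. (2) If $N(\varepsilon_3)=1$: (i) if $Q=2$, then $Am_s(k/\mathbb{Q}(i))=\langle[\mathcal{H}_0],[\mathcal{H}_1],[\mathcal{H}_2],[\mathcal{H}_3]\rangle\subseteq\ker J_{k^{( * )}}$; (ii) if $Q=1$, then $Am_s(k/\mathbb{Q}(i))=\langle[\mathcal{H}_0],[\mathcal{H}_1],[\mathcal{H}_3]\rangle\subseteq\ker J_{k^{( * )}}$.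
   Context: $i=\sqrt{-1}$; $N$ is the norm to $\mathbb{Q}$. For a real biquadratic field $K$ with quadratic subfields $k_1,k_2,k_3$, $q(K/\mathbb{Q})=[E_K:E_{k_1}E_{k_2}E_{k_3}]$, $E$ denoting unit groups. Write $p_1=e^2+4f^2$, $p_2=g^2+4h^2$ with integers $e,f,g,h$, and $\pi_1=e+2if$, $\pi_2=e-2if$, $\pi_3=g+2ih$, $\pi_4=g-2ih$. For $j=1,\dots,4$, $\mathcal{H}_j$ is the prime ideal of $k$ above $\pi_j$ ($\mathcal{H}_j^2=\pi_j\mathcal{O}_k$), and $\mathcal{H}_0$ the prime of $k$ above $1+i$ ($\mathcal{H}_0^2=(1+i)\mathcal{O}_k$). $J_L:\mathbf{C}_k\to\mathbf{C}_L$ is the map on class groups induced by extension of ideals. $Am_s(k/\mathbb{Q}(i))$ is the subgroup of $\mathbf{C}_k$ generated by classes containing an ideal invariant under the nontrivial automorphism of $k/\mathbb{Q}(i)$. *)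

(* Defs.v *)
From mathcomp Require Import all_boot all_order all_algebra all_field.
Set Implicit Arguments. Unset Strict Implicit. Unset Printing Implicit Defensive.
Import Order.TTheory GRing.Theory Num.Theory.
Local Open Scope ring_scope.

Definition cset := algC -> Prop.

Definition set_eq (A B : cset) : Prop := forall x, A x <-> B x.

Definition is_subfield (S : cset) : Prop :=
  [/\ S 0, S 1, (forall x y, S x -> S y -> S (x - y)),
      (forall x y, S x -> S y -> S (x * y)) & (forall x, S x -> S x^-1)].

Definition gen_field (gens : seq algC) : cset :=
  fun x => forall S, is_subfield S -> (forall g, g \in gens -> S g) -> S x.

Definition ring_of_integers (F : cset) : cset := fun x => F x /\ x \in Aint.

Definition is_Omod (O T : cset) : Prop :=
  [/\ (forall x, T x -> O x), T 0, (forall x y, T x -> T y -> T (x + y))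
    & (forall a x, O a -> T x -> T (a * x))].

Definition is_ideal (O I : cset) : Prop := is_Omod O I /\ exists x, x != 0 /\ I x.

Definition gen_mod (O G : cset) : cset :=
  fun x => forall T, is_Omod O T -> (forall g, G g -> T g) -> T x.

Definition ideal_mul (O I J : cset) : cset :=
  gen_mod O (fun z => exists a b, [/\ I a, J b & z = a * b]).

Definition principal_ideal (O : cset) (a : algC) : cset := gen_mod O (fun z => z = a).

Definition is_principal (O I : cset) : Prop := exists a, O a /\ set_eq I (principal_ideal O a).

Definition ideal_equiv (O I J : cset) : Prop :=
  exists a b, [/\ O a, O b, a != 0, b != 0 &
    set_eq (ideal_mul O (principal_ideal O a) I) (ideal_mul O (principal_ideal O b) J)].

(* gen_cls O P I : the class of the ideal I of O belongs to the subgroup of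
   the class group of O generated by the classes of the ideals satisfying P *)
Inductive gen_cls (O : cset) (P : cset -> Prop) : cset -> Prop :=
  | gen_base I J : is_ideal O I -> is_ideal O J -> P J -> ideal_equiv O I J -> gen_cls O P I
  | gen_one I : is_ideal O I -> is_principal O I -> gen_cls O P I
  | gen_mul I J K : is_ideal O I -> gen_cls O P J -> gen_cls O P K ->
      ideal_equiv O I (ideal_mul O J K) -> gen_cls O P I
  | gen_inv I J : is_ideal O I -> gen_cls O P J ->
      is_principal O (ideal_mul O I J) -> gen_cls O P I.

Definition unit_group (O : cset) : cset := fun x => [/\ O x, x != 0 & O x^-1].

Definition index_is (G H : cset) (n : nat) : Prop :=
  exists r : n.-tuple algC, (forall i, G (tnth r i)) /\
    forall g, G g -> exists! i : 'I_n, H (g / tnth r i).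

Definition quad_field (d : nat) : cset := gen_field [:: sqrtC d%:R].

Definition fundamental_unit (d : nat) (eps : algC) : Prop :=
  let E := unit_group (ring_of_integers (quad_field d)) in
  [/\ E eps, 1 < eps &
    forall u, E u -> exists n : int, u = eps ^ n \/ u = - eps ^ n].

Definition qnorm_is (d : nat) (x : algC) (n : algC) : Prop :=
  exists a b : rat, x = ratr a + ratr b * sqrtC d%:R /\
    (ratr a) ^+ 2 - d%:R * (ratr b) ^+ 2 = n.

Definition unit_index_Q (p1 p2 : nat) (n : nat) : Prop :=
  let EK := unit_group (ring_of_integers (gen_field [:: sqrtC 2; sqrtC (p1 * p2)%:R])) in
  let E1 := unit_group (ring_of_integers (quad_field 2)) in
  let E2 := unit_group (ring_of_integers (quad_field (p1 * p2))) in
  let E3 := unit_group (ring_of_integers (quad_field (2 * p1 * p2))) in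
  index_is EK (fun x => exists u1 u2 u3, [/\ E1 u1, E2 u2, E3 u3 & x = u1 * u2 * u3]) n.

Definition sk (p1 p2 : nat) : algC := sqrtC (2 * p1 * p2)%:R.
Definition kfield (p1 p2 : nat) : cset := gen_field [:: sk p1 p2; 'i].
Definition Ok (p1 p2 : nat) : cset := ring_of_integers (kfield p1 p2).
Definition Okstar (p1 p2 : nat) : cset :=
  ring_of_integers (gen_field [:: sqrtC 2; sqrtC p1%:R; sqrtC p2%:R; 'i]).
Definition Qi : cset := gen_field [:: 'i].

(* ideals of O_k invariant under the nontrivial automorphism of k/Q(i),
   a + b sqrt(2p1p2) |-> a - b sqrt(2p1p2) (a, b in Q(i)) *)
Definition ambiguous_ideal (p1 p2 : nat) (J : cset) : Prop :=
  is_ideal (Ok p1 p2) J /\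
  forall a b, Qi a -> Qi b -> J (a + b * sk p1 p2) -> J (a - b * sk p1 p2).

Definition in_Ams (p1 p2 : nat) (I : cset) : Prop := gen_cls (Ok p1 p2) (ambiguous_ideal p1 p2) I.

Definition in_kerJ (p1 p2 : nat) (I : cset) : Prop :=
  is_principal (Okstar p1 p2) (gen_mod (Okstar p1 p2) I).

Definition Ams_result (p1 p2 : nat) (gens : cset -> Prop) : Prop :=
  (forall I, is_ideal (Ok p1 p2) I ->
     (in_Ams p1 p2 I <-> gen_cls (Ok p1 p2) gens I)) /\
  (forall I, in_Ams p1 p2 I -> in_kerJ p1 p2 I).

Definition gauss (x y : int) : algC := x%:~R + 2%:R * 'i * y%:~R.

(* Main.v *)
(** If I^2 = (a) in an integrally closed ring O, then I consists of the z in O with z^2/a in O, so an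
    ideal is determined by a generator of its square; in particular I^2 = (s^2) forces I = (s).

    An ideal J of O_k stable under sqrt d -> - sqrt d (d = 2 p1 p2) has the form
    c (Z[i] a + Z[i] (b + sqrt d)), and then J^2 = (c^2 n) where the prime factors of n divide 4d.
    Those primes are 1 + i and the pi_j, so J is equivalent to a product of the H_j: the group Am_s is
    generated by [H_0], ..., [H_4].  Relations come from elements whose square is known up to a unit:
    (sqrt d / (1 + i))^2 = - i p1 p2 gives [H_1 H_2 H_3 H_4] = 1; if N(eps_3) = -1, then
    (eps_3 + i)^2 = 2 (x + i) eps_3 gives [H_0 H_a H_b] = 1 with a in {1, 2} and b in {3, 4};
    if N(eps_3) = 1 and Q = 1, then (eps_3 +- 1)^2 = 2 (x +- 1) eps_3 gives [H_1 H_2] = 1.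

    For the capitulation, H_0 is generated by 1 - zeta_8, and for p = p1, p2 a solution of
    x^2 + 1 = p y^2 makes pi_j a unit times a square in Q(sqrt p, i). *)

Require Import Defs.
From Stdlib Require Import Classical FunctionalExtensionality PropExtensionality.
From mathcomp Require Import all_boot all_order all_algebra all_field.
From mathcomp Require Import ring lra zify.
Set Implicit Arguments.
Unset Strict Implicit.
Unset Printing Implicit Defensive.
Import Order.TTheory GRing.Theory Num.Theory.
Local Open Scope ring_scope.

(** Neither unique factorisation of ideals nor a class group is set up. An ideal is handled through
    a generator of its square, so relations between classes become identities between elements, and
    factorisation is needed in Z[i] alone. There too Bezout relations replace it: a prime divides,
    or is comaximal with, every element, and the divisors of 4d are treated by removing one prime at
    a time.

    Fields are predicates on [algC], and no automorphism sqrt d -> - sqrt d is built. Integrality is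
    carried across it by evaluating one rational polynomial at a + b s and at a - b s or, for a
    unit, by writing the conjugate as the norm divided by the unit.

    The recurring obstacle is to show that a Gaussian factor z of x + i, whose norm is a square, is
    a unit times a square. For this z must be coprime to its conjugate, so 1 + i must not divide it:
    when x^2 + 1 = p y^2, the congruence p = 1 mod 4 makes x even; when x^2 + 1 = 2 p1 p2 y^2, the
    number x + i is first divided by 1 + i. *)

Lemma set_eqE (A B : cset) : set_eq A B -> A = B.
Proof.
by move=> AB; apply: functional_extensionality => x; apply: propositional_extensionality.
Qed.

(** If m is the minimal polynomial of z^2, then m(X^2) is monic with integer coefficients and
    vanishes at z. This is the form of integral closedness on which the ideals with known square
    rest. *)
Lemma Aint_sqr (z : algC) : z ^+ 2 \in Aint -> z \in Aint.
Proof.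
move=> z2; have [p [Dp mon_p] _] := minCpolyP (z ^+ 2).
have intp : minCpoly (z ^+ 2) \is a polyOver Num.int by exact: z2.
have szX : (1 < size ('X^2 : {poly algC}))%N by rewrite size_polyXn.
apply: (@root_monic_Aint (minCpoly (z ^+ 2) \Po 'X^2)).
- by rewrite /root horner_comp hornerXn; have := root_minCpoly (z ^+ 2).
- rewrite monicE lead_coef_comp // lead_coefXn expr1n mulr1 -monicE Dp map_monic //.
- by apply: polyOver_comp => //; rewrite rpredX // polyOverX.
Qed.

(** * Ideals and their squares *)

Section Subfield.

Variable F : cset.
Hypothesis subF : is_subfield F.

Lemma sf0 : F 0. Proof. by case: subF. Qed.
Lemma sf1 : F 1. Proof. by case: subF. Qed.
Lemma sfB x y : F x -> F y -> F (x - y). Proof. by case: subF => _ _ + _ _; apply. Qed.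
Lemma sfM x y : F x -> F y -> F (x * y). Proof. by case: subF => _ _ _ + _; apply. Qed.
Lemma sfV x : F x -> F x^-1. Proof. by case: subF => _ _ _ _; apply. Qed.
Lemma sfN x : F x -> F (- x). Proof. by move=> /(sfB sf0); rewrite sub0r. Qed.
Lemma sfD x y : F x -> F y -> F (x + y).
Proof. by move=> Fx /sfN; rewrite -{2}[y]opprK; apply: sfB. Qed.
Lemma sf_div x y : F x -> F y -> F (x / y). Proof. by move=> Fx /sfV; apply: sfM. Qed.
Lemma sfX n x : F x -> F (x ^+ n).
Proof. by move=> Fx; elim: n => [|n IH]; [exact: sf1 | rewrite exprS; apply: sfM]. Qed.
Lemma sf_nat n : F n%:R.
Proof. by elim: n => [|n IH]; [exact: sf0 | rewrite -addn1 natrD; apply: sfD => //; exact: sf1]. Qed.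
Lemma sf_int (m : int) : F m%:~R.
Proof. by case: m => n; [exact: sf_nat | rewrite NegzE mulrNz; apply/sfN/sf_nat]. Qed.
Lemma sf_rat (q : rat) : F (ratr q).
Proof. by rewrite /ratr; apply: sf_div; apply: sf_int. Qed.

End Subfield.

Lemma gen_field_subfield gens : is_subfield (gen_field gens).
Proof.
split.
- by move=> S sS _; apply: sf0.
- by move=> S sS _; apply: sf1.
- by move=> x y Hx Hy S sS gS; apply: sfB => //; [apply: Hx | apply: Hy].
- by move=> x y Hx Hy S sS gS; apply: sfM => //; [apply: Hx | apply: Hy].
- by move=> x Hx S sS gS; apply: sfV => //; apply: Hx.
Qed.

Lemma gen_field_gen gens x : x \in gens -> gen_field gens x.
Proof. by move=> gx S _; apply. Qed.

Section IdealArithmetic.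

Variable F : cset.
Hypothesis subF : is_subfield F.
Local Notation O := (ring_of_integers F).

Lemma O1 : O 1. Proof. by split; [exact: sf1 | exact: Aint1]. Qed.
Lemma O0 : O 0. Proof. by split; [exact: sf0 | exact: Aint0]. Qed.
Lemma OD x y : O x -> O y -> O (x + y).
Proof. by move=> [Fx Ax] [Fy Ay]; split; [exact: sfD | exact: rpredD]. Qed.
Lemma OM x y : O x -> O y -> O (x * y).
Proof. by move=> [Fx Ax] [Fy Ay]; split; [exact: sfM | exact: rpredM]. Qed.
Lemma ON x : O x -> O (- x).
Proof. by move=> [Fx Ax]; split; [exact: sfN | rewrite rpredN]. Qed.
Lemma OB x y : O x -> O y -> O (x - y).
Proof. by move=> Ox /ON; apply: OD. Qed.
Lemma O_int (m : int) : O m%:~R.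
Proof. by split; [exact: sf_int | exact: Aint_int]. Qed.
Lemma O_sqr x : F x -> O (x ^+ 2) -> O x.
Proof. by move=> Fx [_ /Aint_sqr]. Qed.

Lemma Omod_O : is_Omod O O.
Proof. by split=> //; [exact: O0 | exact: OD | exact: OM]. Qed.

Lemma gen_mod_Omod G : (forall x, G x -> O x) -> is_Omod O (gen_mod O G).
Proof.
move=> GO; split.
- by move=> x /(_ O Omod_O GO).
- by move=> T [].
- move=> x y Hx Hy T mT GT; have [_ _ TD _] := mT.
  by apply: TD; [apply: Hx | apply: Hy].
- move=> a x Oa Hx T mT GT; have [_ _ _ TM] := mT.
  by apply: TM => //; apply: Hx.
Qed.

Lemma gen_mod_gen (G : cset) x : G x -> gen_mod O G x.
Proof. by move=> Gx T _; apply. Qed.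

Lemma principalE a : O a -> principal_ideal O a = (fun z => exists2 x, O x & z = x * a).
Proof.
move=> Oa; apply: set_eqE => z; split.
- move=> /(_ (fun z => exists2 x, O x & z = x * a)); apply; last by move=> _ ->; exists 1; rewrite ?mul1r //; exact: O1.
  split.
  + by move=> _ [x Ox ->]; apply: OM.
  + by exists 0; rewrite ?mul0r //; exact: O0.
  + move=> _ _ [x Ox ->] [y Oy ->]; exists (x + y); last by rewrite mulrDl.
    exact: OD.
  + move=> b _ Ob [x Ox ->]; exists (b * x); last by rewrite mulrA.
    exact: OM.
- by move=> [x Ox ->] T [_ _ _ TM] /(_ _ erefl) Ta; apply: TM.
Qed.

Lemma principal_mem a x : O a -> O x -> principal_ideal O a (x * a).
Proof. by move=> Oa Ox; rewrite principalE //; exists x. Qed.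

Lemma principal_self a : O a -> principal_ideal O a a.
Proof. by move=> Oa; rewrite -[X in principal_ideal _ _ X]mul1r; apply: principal_mem => //; exact: O1. Qed.

Lemma principal_ideal_ideal a : O a -> a != 0 -> is_ideal O (principal_ideal O a).
Proof.
move=> Oa a0; split; last by exists a; split=> //; exact: principal_self.
by apply: gen_mod_Omod => _ ->.
Qed.

Lemma principal_unit u a : O u -> u != 0 -> O u^-1 -> O a ->
  principal_ideal O (u * a) = principal_ideal O a.
Proof.
move=> Ou u0 Ov Oa; rewrite !principalE //; last exact: OM.
apply: set_eqE => z; split=> [[x Ox ->]|[x Ox ->]].
- by exists (x * u); [apply: OM | rewrite mulrA].
- by exists (x * u^-1); [apply: OM | rewrite mulrA mulfVK].
Qed.

Lemma ideal_O I x : is_ideal O I -> I x -> O x.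
Proof. by move=> [[IO _ _ _] _]; apply: IO. Qed.
Lemma idealD I x y : is_ideal O I -> I x -> I y -> I (x + y).
Proof. by move=> [[_ _ ID _] _]; apply: ID. Qed.
Lemma idealM I a x : is_ideal O I -> O a -> I x -> I (a * x).
Proof. by move=> [[_ _ _ IM] _]; apply: IM. Qed.
Lemma idealN I x : is_ideal O I -> I x -> I (- x).
Proof. by move=> iI Ix; rewrite -mulN1r; apply: idealM => //; apply/ON/O1. Qed.
Lemma idealB I x y : is_ideal O I -> I x -> I y -> I (x - y).
Proof. by move=> iI Ix /(idealN iI); apply: idealD. Qed.

Lemma mul_gen_O I J : is_ideal O I -> is_ideal O J ->
  forall z, (exists a b, [/\ I a, J b & z = a * b]) -> O z.
Proof.
by move=> iI iJ _ [a [b [Ia Jb ->]]]; apply: OM; [apply: ideal_O iI _ | apply: ideal_O iJ _].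
Qed.

Lemma mem_mul (I J : cset) a b : I a -> J b -> ideal_mul O I J (a * b).
Proof. by move=> Ia Jb; apply: gen_mod_gen; exists a, b. Qed.

Lemma mul_ideal I J : is_ideal O I -> is_ideal O J -> is_ideal O (ideal_mul O I J).
Proof.
move=> iI iJ; split; first by apply: gen_mod_Omod; apply: mul_gen_O.
have [_ [x [x0 Ix]]] := iI; have [_ [y [y0 Jy]]] := iJ.
by exists (x * y); rewrite mulf_neq0 //; split=> //; apply: mem_mul.
Qed.

Lemma mul_sub I J (T : cset) : is_Omod O T ->
  (forall a b, I a -> J b -> T (a * b)) -> forall z, ideal_mul O I J z -> T z.
Proof. by move=> mT H z; apply=> // _ [a [b [Ia Jb ->]]]; apply: H. Qed.

Lemma ideal_mulC I J : ideal_mul O I J = ideal_mul O J I.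
Proof.
apply: set_eqE => z; split; move=> Hz T mT HT; apply: Hz => // _ [a [b [Ia Jb ->]]];
by apply: HT; exists b, a; rewrite mulrC.
Qed.

(** Elements of [gen_mod] can only be reached through minimality among modules, so a claim
    [T (z * y)] must first be recast as membership of z in a module. Products are then treated one
    factor at a time. *)
Lemma colon_Omod (T : cset) y : O y -> is_Omod O T -> is_Omod O (fun z => O z /\ T (z * y)).
Proof.
move=> Oy [TO T0 TD TM]; split.
- by move=> x [].
- by rewrite mul0r; split=> //; exact: O0.
- by move=> a b [Oa Ta] [Ob Tb]; split; [exact: OD | rewrite mulrDl; apply: TD].
- by move=> a b Oa [Ob Tb]; split; [exact: OM | rewrite -mulrA; apply: TM].
Qed.

Lemma mul_assoc_sub I J K : is_ideal O I -> is_ideal O J -> is_ideal O K ->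
  forall z, ideal_mul O (ideal_mul O I J) K z -> ideal_mul O I (ideal_mul O J K) z.
Proof.
move=> iI iJ iK; have iR := mul_ideal iI (mul_ideal iJ iK).
apply: mul_sub; first by case: iR.
move=> a b /= Ha Kb; have Ob := ideal_O iK Kb.
suff: O a /\ ideal_mul O I (ideal_mul O J K) (a * b) by case.
move: a Ha; apply: mul_sub; first by apply: colon_Omod => //; case: iR.
move=> a c Ia Jc; split.
  by apply: OM; [apply: ideal_O iI _ | apply: ideal_O iJ _].
by rewrite -mulrA; do !apply: mem_mul.
Qed.

Lemma ideal_mulA I J K : is_ideal O I -> is_ideal O J -> is_ideal O K ->
  ideal_mul O I (ideal_mul O J K) = ideal_mul O (ideal_mul O I J) K.
Proof.
move=> iI iJ iK; apply: set_eqE => z; split; last exact: mul_assoc_sub.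
by rewrite (ideal_mulC I) (ideal_mulC J K) (ideal_mulC _ K) (ideal_mulC I J); apply: mul_assoc_sub.
Qed.

Lemma ideal_mulACA I J K L : is_ideal O I -> is_ideal O J -> is_ideal O K -> is_ideal O L ->
  ideal_mul O (ideal_mul O I J) (ideal_mul O K L) =
  ideal_mul O (ideal_mul O I K) (ideal_mul O J L).
Proof.
move=> iI iJ iK iL.
have H A B : is_ideal O A -> is_ideal O B -> is_ideal O (ideal_mul O A B) by exact: mul_ideal.
rewrite -!ideal_mulA //; try exact: H.
by congr ideal_mul; rewrite !ideal_mulA // (ideal_mulC J).
Qed.

Lemma mul_principal a I : O a -> is_ideal O I ->
  ideal_mul O (principal_ideal O a) I = (fun z => exists2 x, I x & z = a * x).
Proof.
move=> Oa iI; apply: set_eqE => z; split; last first.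
  by move=> [x Ix ->]; apply: mem_mul => //; apply: principal_self.
move: z; apply: mul_sub.
  have [[_ I0 _ _] _] := iI; split.
  - by move=> _ [x Ix ->]; apply: OM => //; apply: ideal_O iI _.
  - by exists 0 => //; rewrite mulr0.
  - by move=> _ _ [x Ix ->] [y Iy ->]; exists (x + y); [apply: idealD | rewrite mulrDr].
  - by move=> b _ Ob [x Ix ->]; exists (b * x); [apply: idealM | rewrite mulrCA].
move=> x y; rewrite principalE // => -[w Ow ->] Iy.
by exists (w * y); [apply: idealM | rewrite mulrAC mulrC].
Qed.

Lemma principal_mul a b : O a -> O b -> b != 0 ->
  ideal_mul O (principal_ideal O a) (principal_ideal O b) = principal_ideal O (a * b).
Proof.
move=> Oa Ob b0; rewrite mul_principal //; last exact: principal_ideal_ideal.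
apply: set_eqE => z; rewrite !principalE //; last exact: OM.
split=> [[_ [y Oy ->] ->]|[y Oy ->]]; first by exists y => //; rewrite mulrCA.
by exists (y * b); [exists y | rewrite mulrCA].
Qed.

Lemma ideal_mul1 I : is_ideal O I -> ideal_mul O I (principal_ideal O 1) = I.
Proof.
move=> iI; rewrite ideal_mulC mul_principal //; last exact: O1.
by apply: set_eqE => z; split=> [[x Ix ->]|Iz]; [rewrite mul1r | exists z; rewrite ?mul1r].
Qed.

(** The generator is the x in I with s = m x. This cancellation stands in for fractional ideals. *)
Lemma mul_principal_cancel I m s : is_ideal O I -> O m -> m != 0 -> O s ->
  ideal_mul O (principal_ideal O m) I = principal_ideal O s -> is_principal O I.
Proof.
move=> iI Om m0 Os; rewrite mul_principal // principalE // => E.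
have {}E z : (exists2 x, I x & z = m * x) <-> (exists2 x, O x & z = x * s).
  by move: (congr1 (fun A : cset => A z) E) => /= ->.
have [x Ix Ds] : exists2 x, I x & s = m * x.
  by apply/E; exists 1; [exact: O1 | rewrite mul1r].
exists x; split; first exact: ideal_O iI _.
move=> z; rewrite principalE; last exact: ideal_O iI _.
split=> [Iz|[y Oy ->]]; last exact: idealM.
have [y Oy Dz] : exists2 y, O y & m * z = y * s by apply/E; exists z.
by exists y => //; apply: (mulfI m0); rewrite Dz Ds mulrCA.
Qed.

Definition sqrt_ideal (a : algC) (I : cset) :=
  [/\ is_ideal O I, O a, a != 0 & ideal_mul O I I = principal_ideal O a].

Lemma sqrt_ideal_sqr a I x : sqrt_ideal a I -> I x -> O (x ^+ 2 / a).
Proof.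
move=> [iI Oa a0 E] Ix; have := mem_mul Ix Ix.
by rewrite E principalE // => -[y Oy]; rewrite -expr2 => ->; rewrite mulfK.
Qed.

(* For x, y with x^2, y^2 in (a), (x y / a)^2 is integral, hence x y lies in (a) = I^2. *)
Lemma sqrt_ideal_mem a I z : sqrt_ideal a I -> O z -> O (z ^+ 2 / a) -> I z.
Proof.
move=> sI Oz Oza; have [iI Oa a0 E] := sI.
have zI y : I y -> O (z * y / a).
  move=> Iy; apply: O_sqr.
    have [[Fz _] [Fa _] [Fy _]] := And3 Oz Oa (ideal_O iI Iy).
    by apply: sf_div => //; apply: sfM.
  suff ->: (z * y / a) ^+ 2 = (z ^+ 2 / a) * (y ^+ 2 / a).
    by apply: OM => //; apply: sqrt_ideal_sqr sI _.
  by field.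
suff: exists2 x, I x & a * z = a * x by move=> [x Ix /(mulfI a0) ->].
(* As a lies in I^2, it suffices to put w z into a I for every w in I^2, and for w = x y one has w z
   = a (z x / a) y. Only the occurrences of [a] that play the part of w are generalised; the factor
   in [a * x] stays fixed. *)
have: ideal_mul O I I a by rewrite E; apply: principal_self.
move=> Ha; suff: O a /\ exists2 x, I x & a * z = a * x by case.
move: {1 2 3}a Ha; apply: mul_sub.
  apply: (@colon_Omod (fun z => exists2 x, I x & z = a * x)) => //.
  rewrite -mul_principal //.
  by case: (mul_ideal (principal_ideal_ideal Oa a0) iI).
move=> x y Ix Iy; split; first by apply: OM; apply: ideal_O iI _.
exists (z * x / a * y); first by apply: idealM => //; apply: zI.
by field.
Qed.

Lemma sqrt_ideal_mul a b I J : sqrt_ideal a I -> sqrt_ideal b J ->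
  sqrt_ideal (a * b) (ideal_mul O I J).
Proof.
move=> [iI Oa a0 EI] [iJ Ob b0 EJ]; split.
- exact: mul_ideal.
- exact: OM.
- exact: mulf_neq0.
- by rewrite ideal_mulACA // EI EJ principal_mul.
Qed.

Lemma sqrt_ideal_principal n I u s : sqrt_ideal n I -> O u -> u != 0 -> O u^-1 ->
  F s -> s ^+ 2 = u * n -> I = principal_ideal O s.
Proof.
move=> sI Ou u0 Ov Fs Ds; have [iI On n0 E] := sI.
have Os : O s by apply: O_sqr => //; rewrite Ds; apply: OM.
have s0 : s != 0 by rewrite -sqrf_eq0 Ds mulf_neq0.
apply: set_eqE => z; rewrite principalE //; split=> [Iz|[y Oy ->]].
  exists (z / s); last by rewrite mulfVK.
  have [Fz _] := ideal_O iI Iz.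
  apply: O_sqr; first exact: sf_div.
  rewrite expr_div_n Ds invfM mulrCA; apply: OM => //.
  exact: sqrt_ideal_sqr sI Iz.
apply: idealM => //; apply: sqrt_ideal_mem sI _ _ => //.
by rewrite Ds mulfK.
Qed.

End IdealArithmetic.

(** * Ideal classes and extension of ideals *)

Section ClassGroup.

Variable F : cset.
Hypothesis subF : is_subfield F.
Local Notation O := (ring_of_integers F).

Lemma gen_cls_ideal P I : gen_cls O P I -> is_ideal O I.
Proof. by case. Qed.

(** [gen_cls] has no constructor for replacing an ideal by an equivalent one; [gen_mul] with the
    unit ideal as second factor supplies it. *)
Lemma gen_cls_equiv P I J : is_ideal O I -> ideal_equiv O I J -> gen_cls O P J -> gen_cls O P I.
Proof.
move=> iI IJ gJ; have iJ := gen_cls_ideal gJ.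
have O1 := O1 subF.
have i1 := principal_ideal_ideal subF O1 (oner_neq0 _).
have g1 : gen_cls O P (principal_ideal O 1) by apply: gen_one => //; exists 1.
by apply: (gen_mul iI gJ g1); rewrite ideal_mul1.
Qed.

Lemma gen_cls_mem (P : cset -> Prop) I : is_ideal O I -> P I -> gen_cls O P I.
Proof.
move=> iI PI; apply: (gen_base iI iI PI).
by exists 1, 1; split=> //; rewrite ?oner_neq0 //; exact: O1.
Qed.

Lemma gen_cls_mul P I J : gen_cls O P I -> gen_cls O P J -> gen_cls O P (ideal_mul O I J).
Proof.
move=> gI gJ; have [iI iJ] := (gen_cls_ideal gI, gen_cls_ideal gJ).
apply: (gen_mul (mul_ideal subF iI iJ) gI gJ).
by exists 1, 1; split=> //; rewrite ?oner_neq0 //; exact: O1.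
Qed.

Lemma gen_cls_trans (P Q : cset -> Prop) I :
  (forall J, is_ideal O J -> P J -> gen_cls O Q J) -> gen_cls O P I -> gen_cls O Q I.
Proof.
move=> PQ; elim=> {I} [I J iI iJ PJ IJ|I iI pI|I J K iI _ gJ _ gK IJK|I J iI _ gJ pIJ].
- by apply: gen_cls_equiv IJ _ => //; apply: PQ.
- exact: gen_one.
- exact: gen_mul gJ gK IJK.
- exact: gen_inv gJ pIJ.
Qed.

(** The entry point of every relation: (I J)^2 = (a b), so s generates I J and the class of I is
    inverse to that of J. *)
Lemma gen_cls_sqrt P I J a b u s : sqrt_ideal F a I -> sqrt_ideal F b J -> gen_cls O P J ->
  unit_group O u -> F s -> s ^+ 2 = u * (a * b) -> gen_cls O P I.
Proof.
move=> sI sJ gJ [Ou u0 Ov] Fs Ds; have sIJ := sqrt_ideal_mul subF sI sJ.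
have [iI _ _ _] := sI; apply: (gen_inv iI gJ).
exists s; split; last by rewrite (sqrt_ideal_principal subF sIJ Ou u0 Ov Fs Ds).
apply: O_sqr => //; rewrite Ds; apply: (OM subF) => //.
by case: sIJ.
Qed.

Lemma sqrt_ideal1 u : unit_group O u -> sqrt_ideal F u (principal_ideal O 1).
Proof.
move=> [Ou u0 Ov]; split=> //; first by apply: principal_ideal_ideal => //; [exact: O1 | exact: oner_neq0].
rewrite principal_mul ?oner_neq0 ?mulr1 //; try exact: O1.
by rewrite -[u]mulr1 principal_unit //; exact: O1.
Qed.

Lemma gen_cls1 P : gen_cls O P (principal_ideal O 1).
Proof.
have O1 := O1 subF; apply: gen_one; last by exists 1.
by apply: principal_ideal_ideal => //; exact: oner_neq0.
Qed.

End ClassGroup.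

Section Extension.

Variables F F' : cset.
Hypotheses (subF : is_subfield F) (subF' : is_subfield F').
Hypothesis FF' : forall x, F x -> F' x.
Local Notation O := (ring_of_integers F).
Local Notation O' := (ring_of_integers F').
Local Notation ext := (gen_mod O').

Lemma O_ext x : O x -> O' x.
Proof. by move=> [/FF' Fx Ax]. Qed.

Lemma ext_sub_O I : is_ideal O I -> forall x, I x -> O' x.
Proof. by move=> iI x /(ideal_O iI)/O_ext. Qed.

Lemma ext_ideal I : is_ideal O I -> is_ideal O' (ext I).
Proof.
move=> iI; split; first by apply: gen_mod_Omod => //; apply: ext_sub_O.
by have [_ [x [x0 Ix]]] := iI; exists x; split=> //; apply: gen_mod_gen.
Qed.

Lemma ext_principal a : O a -> ext (principal_ideal O a) = principal_ideal O' a.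
Proof.
move=> Oa; have O'a := O_ext Oa; apply: set_eqE => z; split.
- apply; first by apply: gen_mod_Omod => // _ ->.
  by move=> x; rewrite !principalE // => -[y Oy ->]; exists y => //; apply: O_ext.
- apply; last by move=> _ ->; apply: gen_mod_gen; apply: principal_self.
  apply: gen_mod_Omod => // x; rewrite principalE // => -[y Oy ->].
  by apply: O_ext; apply: OM.
Qed.

(** Contraction to O lets the minimality of a module generated over O be applied to a target that is
    a module over O'. *)
Lemma restrict_Omod T : is_Omod O' T -> is_Omod O (fun x => O x /\ T x).
Proof.
move=> [TO T0 TD TM]; split=> [x []//||x y [Ox Tx] [Oy Ty]|a x Oa [Ox Tx]].
- by split=> //; apply: O0.
- by split; [apply: OD | apply: TD].
- by split; [apply: OM | apply: TM => //; apply: O_ext].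
Qed.

Lemma ext_mul I J : is_ideal O I -> is_ideal O J ->
  ext (ideal_mul O I J) = ideal_mul O' (ext I) (ext J).
Proof.
move=> iI iJ; have [eI eJ] := (ext_ideal iI, ext_ideal iJ).
have iIJ := mul_ideal subF iI iJ.
have [mEE _] := mul_ideal subF' eI eJ; have [mP _] := ext_ideal iIJ.
apply: set_eqE => z; split.
- apply=> // x; suff: forall x, ideal_mul O I J x -> O x /\ ideal_mul O' (ext I) (ext J) x.
    by move=> H /H [].
  move=> {}x; move: x; apply: mul_sub; first exact: restrict_Omod.
  move=> a b Ia Jb; split; last by apply: mem_mul; apply: gen_mod_gen.
  by apply: OM => //; [apply: ideal_O iI _ | apply: ideal_O iJ _].
- move: z; apply: mul_sub => // a b Ha Hb.
  have aJ c : J c -> ext (ideal_mul O I J) (a * c).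
    move=> Jc; suff: O' a /\ ext (ideal_mul O I J) (a * c) by case.
    apply: (Ha (fun a => O' a /\ ext (ideal_mul O I J) (a * c))); first by apply: colon_Omod => //; apply: ext_sub_O iJ _ _.
    move=> x Ix; split; first by apply: ext_sub_O iI _ _.
    by apply: gen_mod_gen; apply: mem_mul.
  suff: O' b /\ ext (ideal_mul O I J) (b * a) by rewrite mulrC => -[].
  apply: (Hb (fun b => O' b /\ ext (ideal_mul O I J) (b * a))); first by apply: colon_Omod => //; apply: ideal_O eI _.
  by move=> x Jx; split; [apply: ext_sub_O iJ _ _ | rewrite mulrC; apply: aJ].
Qed.

Lemma ext_sqrt a I : sqrt_ideal F a I -> sqrt_ideal F' a (ext I).
Proof.
move=> [iI Oa a0 E]; split=> //; [exact: ext_ideal | exact: O_ext |].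
by rewrite -ext_mul // E ext_principal.
Qed.

Lemma principal_neq0 I y : is_ideal O' I -> set_eq I (principal_ideal O' y) -> O' y -> y != 0.
Proof.
move=> [_ [x [x0 Ix]]] Iy Oy; move/Iy: Ix; rewrite principalE // => -[w _ Dx].
by apply: contraNneq x0 => y0; rewrite Dx y0 mulr0.
Qed.

(** From a I = b J and J O' = (y) follows a (I O') = (y b), and a cancels. *)
Lemma ext_equiv_principal I J : is_ideal O I -> is_ideal O J -> ideal_equiv O I J ->
  is_principal O' (ext J) -> is_principal O' (ext I).
Proof.
move=> iI iJ [a [b [Oa Ob a0 b0 E]]] [y [Oy Dy]].
have y0 := principal_neq0 (ext_ideal iJ) Dy Oy.
have [O'a O'b] := (O_ext Oa, O_ext Ob).
apply: (@mul_principal_cancel _ subF' _ a (y * b)) => //; [exact: ext_ideal | exact: OM |].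
rewrite -ext_principal // -ext_mul //; last exact: principal_ideal_ideal.
rewrite (set_eqE E) ext_mul //; last exact: principal_ideal_ideal.
by rewrite ext_principal // (set_eqE Dy) ideal_mulC principal_mul.
Qed.

Lemma gen_cls_capitulates P I : (forall J, is_ideal O J -> P J -> is_principal O' (ext J)) ->
  gen_cls O P I -> is_principal O' (ext I).
Proof.
move=> capP; elim=> {I} [I J iI iJ PJ IJ|I iI [a [Oa E]]|I J K iI gJ pJ gK pK IJK|I J iI gJ pJ [s [Os E]]].
- by apply: ext_equiv_principal IJ _ => //; apply: capP.
- by exists a; split; [exact: O_ext | rewrite (set_eqE E) ext_principal].
- have [iJ iK] := (gen_cls_ideal gJ, gen_cls_ideal gK).
  apply: ext_equiv_principal IJK _ => //; first exact: mul_ideal.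
  have [[x [Ox Dx]] [y [Oy Dy]]] := (pJ, pK); exists (x * y); split; first exact: OM.
  rewrite ext_mul // (set_eqE Dx) (set_eqE Dy) principal_mul //.
  exact: principal_neq0 (ext_ideal iK) Dy Oy.
- have iJ := gen_cls_ideal gJ; have [x [Ox Dx]] := pJ.
  apply: (@mul_principal_cancel _ subF' _ x s) => //; [exact: ext_ideal | | exact: O_ext |].
    exact: principal_neq0 (ext_ideal iJ) Dx Ox.
  by rewrite -(ext_principal Os) -(set_eqE E) ext_mul // (set_eqE Dx) ideal_mulC.
Qed.

End Extension.

(** * Gaussian integers *)

Lemma quad_subfield (K : cset) s : is_subfield K -> K (s ^+ 2) ->
  is_subfield (fun x => exists a b, [/\ K a, K b & x = a + b * s]).
Proof.
move=> sK Ks; split.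
- by exists 0, 0; rewrite mul0r addr0; split=> //; exact: sf0.
- by exists 1, 0; rewrite mul0r addr0; split=> //; [exact: sf1 | exact: sf0].
- move=> _ _ [a [b [Ka Kb ->]]] [c [d [Kc Kd ->]]].
  by exists (a - c), (b - d); split; [apply: sfB | apply: sfB | ring].
- move=> _ _ [a [b [Ka Kb ->]]] [c [d [Kc Kd ->]]].
  exists (a * c + b * d * s ^+ 2), (a * d + b * c).
  split; last by ring.
    by apply: sfD => //; do !apply: sfM => //.
  by apply: sfD => //; apply: sfM.
(* Since s may lie in K, the conjugate a - b s can vanish; then a + b s = 2 a is inverted inside K.
   Otherwise the inverse is the conjugate over the norm, with 0^-1 = 0 when a + b s = 0. *)
- move=> _ [a [b [Ka Kb ->]]]; have [E|n0] := eqVneq (a - b * s) 0.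
    exists (a + a)^-1, 0; rewrite mul0r addr0; split; [by apply: sfV => //; apply: sfD | exact: sf0 |].
    by congr (_^-1); rewrite -{3}[a]subr0 -E; ring.
  have KN : K (a ^+ 2 - b ^+ 2 * s ^+ 2).
    by apply: sfB => //; [apply: sfX | apply: sfM => //; apply: sfX].
  exists (a / (a ^+ 2 - b ^+ 2 * s ^+ 2)), (- b / (a ^+ 2 - b ^+ 2 * s ^+ 2)).
  split; [exact: sf_div | by apply: sf_div => //; apply: sfN |].
  have -> : a ^+ 2 - b ^+ 2 * s ^+ 2 = (a + b * s) * (a - b * s) by ring.
  have [->|m0] := eqVneq (a + b * s) 0; first by rewrite mul0r invr0 !mulr0 mul0r addr0.
  by field; rewrite n0 m0.
Qed.

Lemma Crat_subfield : is_subfield (fun x => exists r : rat, x = ratr r).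
Proof.
split; [by exists 0; rewrite rmorph0 | by exists 1; rewrite rmorph1 | | |].
- by move=> _ _ [a ->] [b ->]; exists (a - b); rewrite rmorphB.
- by move=> _ _ [a ->] [b ->]; exists (a * b); rewrite rmorphM.
- by move=> _ [a ->]; exists a^-1; rewrite fmorphV.
Qed.

Lemma gen_quadP s (q : rat) x : s ^+ 2 = ratr q -> gen_field [:: s] x ->
  exists a b : rat, x = ratr a + ratr b * s.
Proof.
move=> Ds; case/(_ _ (quad_subfield Crat_subfield (ex_intro _ q Ds))).
  move=> g; rewrite inE => /eqP ->; exists 0, 1; rewrite mul1r add0r; split=> //.
    by exists 0; rewrite rmorph0.
  by exists 1; rewrite rmorph1.
by move=> _ [_ [[a ->] [b ->] ->]]; exists a, b.
Qed.

Lemma Qi_subfield : is_subfield Qi. Proof. exact: gen_field_subfield. Qed.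

Lemma Qi_i : Qi 'i. Proof. by apply: gen_field_gen; rewrite inE. Qed.

Lemma QiP x : Qi x -> exists a b : rat, x = ratr a + ratr b * 'i.
Proof. by apply: (@gen_quadP _ (-1)); rewrite sqrCi rmorphN rmorph1. Qed.

Lemma gen_quad_iP s x : Qi (s ^+ 2) -> gen_field [:: s; 'i] x ->
  exists a b, [/\ Qi a, Qi b & x = a + b * s].
Proof.
move=> Ds; case/(_ _ (quad_subfield Qi_subfield Ds)).
  have [Q0 Q1] := (sf0 Qi_subfield, sf1 Qi_subfield).
  move=> g; rewrite !inE => /orP[] /eqP ->; first by exists 0, 1; rewrite mul1r add0r.
  by exists 'i, 0; rewrite mul0r addr0; split=> //; exact: Qi_i.
by move=> a [b H]; exists a, b.
Qed.

Definition Zi (x : algC) := exists a b : int, x = a%:~R + b%:~R * 'i.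

Lemma Zi_int (m : int) : Zi m%:~R.
Proof. by exists m, 0; rewrite mul0r addr0. Qed.
Lemma Zi_nat n : Zi n%:R. Proof. exact: Zi_int n%:Z. Qed.
Lemma Zi0 : Zi 0. Proof. exact: Zi_nat 0%N. Qed.
Lemma Zi1 : Zi 1. Proof. exact: Zi_nat 1%N. Qed.
Lemma Zi_i : Zi 'i. Proof. by exists 0, 1; rewrite mul1r add0r. Qed.
Lemma ZiD x y : Zi x -> Zi y -> Zi (x + y).
Proof.
by move=> [a [b ->]] [c [d ->]]; exists (a + c), (b + d); rewrite !rmorphD /=; ring.
Qed.
Lemma ZiN x : Zi x -> Zi (- x).
Proof. by move=> [a [b ->]]; exists (- a), (- b); rewrite !rmorphN /=; ring. Qed.
Lemma ZiB x y : Zi x -> Zi y -> Zi (x - y).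
Proof. by move=> Zx /ZiN; apply: ZiD. Qed.
Lemma ZiM x y : Zi x -> Zi y -> Zi (x * y).
Proof.
move=> [a [b ->]] [c [d ->]]; exists (a * c - b * d), (a * d + b * c).
rewrite !(rmorphD, rmorphN, rmorphM) /=.
have -> : (a%:~R + b%:~R * 'i) * (c%:~R + d%:~R * 'i) =
  a%:~R * c%:~R + (a%:~R * d%:~R + b%:~R * c%:~R) * 'i + b%:~R * d%:~R * 'i ^+ 2 :> algC by ring.
by rewrite sqrCi; ring.
Qed.
Lemma ZiX n x : Zi x -> Zi (x ^+ n).
Proof. by move=> Zx; elim: n => [|n IH]; [exact: Zi1 | rewrite exprS; apply: ZiM]. Qed.

Lemma conj_int_i (a b : int) : (a%:~R + b%:~R * 'i)^* = a%:~R - b%:~R * 'i :> algC.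
Proof. by rewrite rmorphD rmorphM /= !rmorph_int conjCi mulrN. Qed.

Lemma Zi_conj x : Zi x -> Zi x^*.
Proof.
by move=> [a [b ->]]; exists a, (- b); rewrite conj_int_i rmorphN /=; ring.
Qed.

Lemma Zi_Qi x : Zi x -> Qi x.
Proof.
have sQ := Qi_subfield; move=> [a [b ->]].
by apply: (sfD sQ); [apply: sf_int | apply: (sfM sQ); [apply: sf_int | apply: Qi_i]].
Qed.

Lemma Aint_i : 'i \in Aint.
Proof. by apply: Aint_sqr; rewrite sqrCi rpredN; exact: Aint1. Qed.

Lemma Zi_Aint x : Zi x -> x \in Aint.
Proof.
by move=> [a [b ->]]; rewrite rpredD ?rpredM ?Aint_int //; exact: Aint_i.
Qed.

Lemma Zi_O F x : is_subfield F -> F 'i -> Zi x -> ring_of_integers F x.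
Proof.
move=> sF Fi Zx; split; last exact: Zi_Aint.
by have [a [b ->]] := Zx; apply: sfD => //; [apply: sf_int | apply: sfM => //; apply: sf_int].
Qed.

Lemma rat_Aint (r : rat) : ratr r \in Aint -> exists m : int, ratr r = m%:~R :> algC.
Proof. by move=> Ar; apply/intrP; apply: Cint_rat_Aint => //; apply: Crat_rat. Qed.

Lemma ratr_int_inj (r : rat) (m : int) : ratr r = m%:~R :> algC -> r = m%:~R.
Proof. by rewrite -(ratr_int _ m) => /fmorph_inj. Qed.

Lemma int_parity (m : int) : exists q, m = 2 * q \/ m = 2 * q + 1.
Proof. by exists (m %/ 2)%Z; lia. Qed.

(** The numbers m = 2a, n = 2b and k = a^2 + b^2 are rational and integral, hence integers. Then m^2
    + n^2 = 4k forces m and n to be even. *)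
Lemma Qi_Aint x : Qi x -> x \in Aint -> Zi x.
Proof.
move=> /QiP[a [b Dx]] Ax; have Axc : x^* \in Aint by rewrite (Aint_aut Num.conj).
have Dxc : x^* = ratr a - ratr b * 'i.
  by rewrite Dx rmorphD (rmorphM _ (ratr b)) /= conjCi mulrN !conj_Crat ?Crat_rat.
have [m Dm] : exists m : int, ratr (2 * a) = m%:~R :> algC.
  apply: rat_Aint; have ->: ratr (2 * a) = x + x^* by rewrite Dxc Dx rmorphM /= ratr_nat; ring.
  exact: rpredD.
have [n Dn] : exists n : int, ratr (2 * b) = n%:~R :> algC.
  apply: rat_Aint; have ->: ratr (2 * b) = 'i * (x^* - x).
    by rewrite Dxc Dx rmorphM /= ratr_nat; ring: (sqrCi algC).
  by rewrite rpredM ?rpredB //; exact: Aint_i.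
have [k Dk] : exists k : int, ratr (a ^+ 2 + b ^+ 2) = k%:~R :> algC.
  apply: rat_Aint; have ->: ratr (a ^+ 2 + b ^+ 2) = x * x^*.
    by rewrite Dxc Dx rmorphD !rmorphXn /=; ring: (sqrCi algC).
  by rewrite rpredM.
move: Dm Dn Dk => /ratr_int_inj Dm /ratr_int_inj Dn /ratr_int_inj Dk.
have E : m ^+ 2 + n ^+ 2 = 4 * k.
  apply: (@intr_inj rat); rewrite rmorphD !rmorphXn rmorphM /= -Dm -Dn -Dk.
  by ring.
have [m' [n' [Dm' Dn']]] : exists m' n', m = 2 * m' /\ n = 2 * n'.
  move: E; have [m' [] ->] := int_parity m; have [n' [] ->] := int_parity n; try by lia.
  by exists m', n'.
have two : (2 : rat) != 0 by [].
have Da : a = m'%:~R by apply: (mulfI two); rewrite Dm Dm' rmorphM.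
have Db : b = n'%:~R by apply: (mulfI two); rewrite Dn Dn' rmorphM.
by exists m', n'; rewrite Dx Da Db !ratr_int.
Qed.

Lemma Zi_norm x : Zi x -> exists n : nat, x * x^* = n%:R.
Proof.
move=> [a [b Dx]]; exists (absz (a ^+ 2 + b ^+ 2)%R).
rewrite pmulrn gez0_abs; last by rewrite addr_ge0 ?sqr_ge0.
by rewrite Dx conj_int_i rmorphD !rmorphXn /=; ring: (sqrCi algC).
Qed.

Lemma mul_conj_eq0 (x : algC) : (x * x^* == 0) = (x == 0).
Proof. by rewrite -normCK sqrf_eq0 normr_eq0. Qed.

(** Rounding a / n to the nearest integer, as the floor of (2a + n) / (2n). The bound on r is
    squared because it enters a norm. *)
Lemma near_quotient (a : int) (n : nat) : (0 < n)%N ->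
  exists q r : int, a = q * n%:Z + r /\ (2 * r) ^+ 2 <= n%:Z ^+ 2.
Proof.
move=> n0; exists ((2 * a + n%:Z) %/ (2 * n%:Z))%Z, (a - ((2 * a + n%:Z) %/ (2 * n%:Z))%Z * n%:Z).
split; first by lia.
set q := (_ %/ _)%Z; have H1 : 2 * a + n%:Z - q * (2 * n%:Z) >= 0 by rewrite /q; lia.
have H2 : 2 * a + n%:Z - q * (2 * n%:Z) < 2 * n%:Z by rewrite /q; lia.
by nia.
Qed.

(** Both coordinates of x / y = x y^* / m are rounded; the error has norm at most 1/4 + 1/4 < 1. *)
Lemma Zi_euclid x y (m : nat) : Zi x -> Zi y -> y != 0 -> y * y^* = m%:R ->
  exists q (n : nat), [/\ Zi q, (x - q * y) * (x - q * y)^* = n%:R & (n < m)%N].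
Proof.
move=> Zx Zy y0 Dm.
have m0 : (0 < m)%N by rewrite lt0n -(pnatr_eq0 algC) -Dm mul_conj_eq0.
have [a [b Dab]] := ZiM Zx (Zi_conj Zy).
have [qa [ra [Da Ra]]] := near_quotient a m0; have [qb [rb [Db Rb]]] := near_quotient b m0.
pose q : algC := qa%:~R + qb%:~R * 'i; have Zq : Zi q by exists qa, qb.
have [n Dn] := Zi_norm (ZiB Zx (ZiM Zq Zy)).
exists q, n; split=> //.
have E : (x - q * y) * y^* = ra%:~R + rb%:~R * 'i.
  rewrite mulrBl Dab -mulrA Dm Da Db !rmorphD !rmorphM /= /q.
  by rewrite -!pmulrn; ring.
have : (n%:R * m%:R : algC) = (ra ^+ 2 + rb ^+ 2)%:~R.
  rewrite -Dn -Dm; have -> : (x - q * y) * (x - q * y)^* * (y * y^*) =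
    ((x - q * y) * y^*) * ((x - q * y) * y^*)^* by rewrite rmorphM /= conjCK; ring.
  by rewrite E conj_int_i rmorphD !rmorphXn /=; ring: (sqrCi algC).
rewrite -natrM -[X in X = _]/((n * m)%N%:Z%:~R) => /intr_inj.
by nia.
Qed.

(** Closure under x - q y already makes S an ideal of Z[i]; an element of minimal nonzero norm
    generates it. Since S is an arbitrary predicate, the descent decides classically whether a
    smaller nonzero remainder exists. *)
Lemma Zi_pid (S : cset) : (forall x, S x -> Zi x) ->
  (forall x y q, S x -> S y -> Zi q -> S (x - q * y)) -> (exists2 x, S x & x != 0) ->
  exists g, [/\ S g, g != 0 & forall x, S x -> exists2 q, Zi q & x = q * g].
Proof.
move=> SZ SB [x0 Sx0 nz0]; have [n0 Dn0] := Zi_norm (SZ _ Sx0).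
elim/ltn_ind: n0 x0 Sx0 nz0 Dn0 => n IH g Sg g0 Dn.
have [[x [q [m [Sx Zq rn0 Dm lt_mn]]]]|H] := classic (exists x q m,
  [/\ S x, Zi q, x - q * g != 0, (x - q * g) * (x - q * g)^* = m%:R & (m < n)%N]).
  by apply: (IH m lt_mn (x - q * g)) => //; apply: SB.
exists g; split=> // x Sx; have [q [m [Zq Dm lt_mn]]] := Zi_euclid (SZ _ Sx) (SZ _ Sg) g0 Dn.
exists q => //; apply/eqP; rewrite -subr_eq0; apply: contraT => nz.
by case: H; exists x, q, m.
Qed.

Lemma Zi_gcd a w : Zi a -> Zi w -> a != 0 ->
  exists g u v a' w', [/\ [/\ Zi g, Zi u & Zi v], Zi a', Zi w', g = u * a + v * w &
    a = a' * g /\ w = w' * g].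
Proof.
move=> Za Zw a0.
have [|x y q [u [v [Zu Zv ->]]] [u' [v' [Zu' Zv' ->]]] Zq||g [[u [v [Zu Zv Dg]]] g0 Hg]] :=
  @Zi_pid (fun x => exists u v, [/\ Zi u, Zi v & x = u * a + v * w]).
- by move=> _ [u [v [Zu Zv ->]]]; apply: ZiD; apply: ZiM.
- exists (u - q * u'), (v - q * v'); split; [| |ring].
    by apply: ZiB => //; apply: ZiM.
  by apply: ZiB => //; apply: ZiM.
- exists a => //; exists 1, 0; split; [exact: Zi1 | exact: Zi0 | ring].
have [|a' Za' Da] := Hg a; first by exists 1, 0; split; [exact: Zi1 | exact: Zi0 | ring].
have [|w' Zw' Dw] := Hg w; first by exists 0, 1; split; [exact: Zi0 | exact: Zi1 | ring].
exists g, u, v, a', w'; split=> //; split=> //.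
by rewrite Dg; apply: ZiD; apply: ZiM.
Qed.

(** Primality in Bezout form, from which both Euclid's lemma and the removal of one prime from a
    divisor follow directly. *)
Definition Zi_prime (q : algC) := [/\ Zi q, q != 0 & forall z, Zi z ->
  (exists2 w, Zi w & z = q * w) \/ exists u v, [/\ Zi u, Zi v & u * q + v * z = 1]].

Lemma Zi_prime_norm q p : Zi q -> q * q^* = p%:R -> prime p -> Zi_prime q.
Proof.
move=> Zq Dp pr_p; have q0 : q != 0 by rewrite -mul_conj_eq0 Dp pnatr_eq0 -lt0n prime_gt0.
split=> // z Zz.
have [g [u [v [c [w [[Zg Zu Zv] Zc Zw Dg [Dq Dz]]]]]]] := Zi_gcd Zq Zz q0.
have [[m Dm] [n Dn]] := (Zi_norm Zc, Zi_norm Zg).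
have Emn : (m * n)%N = p.
  by apply/eqP; rewrite -(eqr_nat algC) natrM -Dm -Dn -Dp Dq rmorphM; apply/eqP; rewrite /=; ring.
have /orP[/eqP m1|/eqP np] : (m == 1)%N || (m == p)%N.
  by have /primeP[_ /(_ m)] := pr_p; apply; rewrite -Emn dvdn_mulr.
  left; exists (w * c^*); first by apply: ZiM => //; apply: Zi_conj.
  rewrite Dz Dq; have -> : c * g * (w * c^*) = c * c^* * (w * g) by ring.
  by rewrite Dm m1 mul1r.
right; have n1 : n = 1%N.
  by apply/eqP; rewrite -(eqn_pmul2l (prime_gt0 pr_p)) muln1 -{1}np Emn.
exists (g^* * u), (g^* * v); split; try by apply: ZiM => //; apply: Zi_conj.
by rewrite -!mulrA -mulrDr -Dg mulrC Dn n1.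
Qed.

Lemma Zi_prime_dvd q x y : Zi_prime q -> Zi x -> Zi y ->
  (exists2 w, Zi w & x * y = q * w) -> (exists2 w, Zi w & x = q * w) \/ (exists2 w, Zi w & y = q * w).
Proof.
move=> [Zq q0 Hq] Zx Zy [w Zw Dw]; have [|[u [v [Zu Zv E]]]] := Hq x Zx; [by left | right].
exists (u * y + v * w); first by apply: ZiD; apply: ZiM.
transitivity (u * q * y + v * (x * y)); first by rewrite -[LHS]mul1r -E; ring.
by rewrite Dw; ring.
Qed.

(* With s = gcd (z, y), one has s^2 | z because z is coprime to w, and z | s^2. *)
Lemma Zi_coprime_square z w y : Zi z -> Zi w -> Zi y -> z != 0 -> z * w = y ^+ 2 ->
  (exists c d, [/\ Zi c, Zi d & c * z + d * w = 1]) ->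
  exists s t, [/\ Zi s, Zi t, Zi t^-1, t != 0 & z = t * s ^+ 2].
Proof.
move=> Zz Zw Zy z0 E [c [d [Zc Zd Ecd]]].
have [s [u [v [z' [y' [[Zs Zu Zv] Zz' Zy' Ds [Dz Dy]]]]]]] := Zi_gcd Zz Zy z0.
(* The cofactors of the two divisibilities: z = c z^2 + d z w = c z^2 + d y^2 = t s^2, and s^2 = (u
   z + v y)^2 = r z because y^2 = z w. Hence t r = 1. *)
pose t := c * z' ^+ 2 + d * y' ^+ 2; pose r := u ^+ 2 * z + 2 * u * v * y + v ^+ 2 * w.
have Zt : Zi t by apply: ZiD; apply: ZiM => //; apply: ZiX.
have Zr : Zi r.
  apply: ZiD; last by apply: ZiM => //; apply: ZiX.
  apply: ZiD; first by apply: ZiM => //; apply: ZiX.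
  by do 3!apply: ZiM => //; apply: Zi_nat.
have Ezt : z = t * s ^+ 2.
  transitivity (c * z ^+ 2 + d * (z * w)).
    by rewrite -[LHS]mulr1 -Ecd; ring.
  by rewrite E {1}Dz Dy /t; ring.
have Esr : s ^+ 2 = r * z.
  by rewrite Ds /r sqrrD !exprMn -E; ring.
have Etr : t * r = 1 by apply: (mulIf z0); rewrite -mulrA -Esr -Ezt mul1r.
have t0 : t != 0 by apply: contraNneq z0 => t0; rewrite Ezt t0 mul0r.
exists s, t; split=> //.
by have -> : t^-1 = r by apply: (mulfI t0); rewrite mulfV.
Qed.

(* z is a root of (X^2 - t1 X + n1)^2 + (t2 X - n2)^2, the norm of X^2 - t X + n. *)
Lemma Aint_quadratic (t n z : algC) : Zi t -> Zi n -> z ^+ 2 = t * z - n -> z \in Aint.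
Proof.
move=> [t1 [t2 Dt]] [n1 [n2 Dn]] Ez.
pose c : seq int := [:: n1 ^+ 2 + n2 ^+ 2; - 2 * (t1 * n1 + t2 * n2);
  t1 ^+ 2 + 2 * n1 + t2 ^+ 2; - 2 * t1].
pose p : {poly algC} := 'X^4 + \poly_(i < 4) (nth 0 c i)%:~R.
apply: (@root_monic_Aint p).
- rewrite /root /p hornerD hornerXn horner_poly !big_ord_recr big_ord0 /=.
  rewrite !(rmorphD, rmorphN, rmorphM, rmorphXn) /=.
  have : (z ^+ 2 - t1%:~R * z + n1%:~R) ^+ 2 + (t2%:~R * z - n2%:~R) ^+ 2 = 0.
    have -> : z ^+ 2 - t1%:~R * z + n1%:~R = 'i * (t2%:~R * z - n2%:~R).
      by rewrite Ez Dt Dn; ring.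
    by rewrite exprMn sqrCi; ring.
  by move=> H; apply/eqP; rewrite -[RHS]H; ring.
- by rewrite monicE lead_coefDl ?lead_coefXn // size_polyXn ltnS size_poly.
- apply/polyOverP => i; rewrite coefD coefXn coef_poly.
  by rewrite rpredD ?rpred_nat //; case: ifP => _; rewrite ?rpred0 ?intr_int.
Qed.

(** A rational polynomial takes values P + R s and P - R s at a + b s and a - b s, with P and R in
    Q(i). If the first value is 0, then P = R = 0 because s is not in Q(i), so both numbers are
    roots of the same minimal polynomial. *)
Lemma Aint_conj_quad (s a b : algC) : Qi (s ^+ 2) -> ~ Qi s -> Qi a -> Qi b ->
  a + b * s \in Aint -> a - b * s \in Aint.
Proof.
have sQ := Qi_subfield; move=> Qs nQs Qa Qb Ax; set x := a + b * s in Ax *.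
have [p [Dp mon_p] _] := minCpolyP x.
have [P [R [QP QR EP ER]]] : exists P R, [/\ Qi P, Qi R, (minCpoly x).[a + b * s] = P + R * s &
    (minCpoly x).[a - b * s] = P - R * s].
  rewrite Dp; elim/poly_ind: (p) => [|q c [P [R [QP QR EP ER]]]].
    by exists 0, 0; rewrite rmorph0 !horner0 mul0r addr0 subr0; split=> //; apply: (sf0 sQ).
  rewrite rmorphD rmorphM /= map_polyX map_polyC /= !hornerE EP ER.
  exists (P * a + R * b * s ^+ 2 + ratr c), (P * b + R * a); split; [| | ring | ring].
    exact: (sfD sQ (sfD sQ (sfM sQ QP Qa) (sfM sQ (sfM sQ QR Qb) Qs)) (sf_rat sQ c)).
  exact: (sfD sQ (sfM sQ QP Qb) (sfM sQ QR Qa)).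
have /eqP := root_minCpoly x; rewrite EP => P0.
have R0 : R = 0.
  apply/eqP; apply: contraT => R0; case: nQs.
  have -> : s = - P / R.
    by apply: (mulIf R0); rewrite mulfVK // -[LHS]subr0 -P0; ring.
  by apply: (sf_div sQ) => //; apply: (sfN sQ).
move: P0; rewrite R0 mul0r addr0 => P0.
apply: (@root_monic_Aint (minCpoly x)); last exact: Ax.
- by rewrite /root ER P0 R0 mul0r subr0.
- by rewrite Dp map_monic.
Qed.

(** * Pell equations *)

Section River.

Variable p : int.
Hypothesis p_nonsquare : forall t : int, t ^+ 2 != p.

Definition pellQ (x y : int) := x ^+ 2 - p * y ^+ 2.

(* Conway's river of the form x^2 - p y^2: the columns (x, y), (z, w) of a unimodular matrix span a
   basis on which the form takes values of opposite signs.  The transformed form is bounded and the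
   step is injective on forms, so the initial form recurs, giving a nontrivial automorph. *)
Definition river_step (v : int * int * int * int) :=
  let: (x, y, z, w) := v in
  if 0 < pellQ (x + z) (y + w) then (x + z, y + w, z, w) else (x, y, x + z, y + w).

Definition river_form (v : int * int * int * int) :=
  let: (x, y, z, w) := v in (pellQ x y, x * z - p * y * w, pellQ z w).

Definition river_ok (v : int * int * int * int) :=
  let: (x, y, z, w) := v in
  [/\ [/\ 0 <= x, 0 <= y, 0 <= z & 0 <= w], x * w = y * z + 1, 0 < pellQ x y & pellQ z w < 0].

Definition form_step (f : int * int * int) :=
  let: (a, b, c) := f in
  if 0 < a + 2 * b + c then (a + 2 * b + c, b + c, c) else (a, a + b, a + 2 * b + c).

Definition form_ok (f : int * int * int) :=
  let: (a, b, c) := f in [/\ 0 < a, c < 0 & b ^+ 2 - a * c = p].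

(** A change of basis of determinant 1 preserves b^2 - a c, which is p for the initial form. *)
Lemma river_form_ok v : river_ok v -> form_ok (river_form v).
Proof.
case: v => [[[x y] z] w] [_ det a0 c0]; split=> //; rewrite /pellQ.
have -> : (x * z - p * y * w) ^+ 2 - (x ^+ 2 - p * y ^+ 2) * (z ^+ 2 - p * w ^+ 2) =
  p * (x * w - y * z) ^+ 2 by ring.
by rewrite det addrAC subrr add0r expr1n mulr1.
Qed.

Lemma river_form_step v : river_form (river_step v) = form_step (river_form v).
Proof.
case: v => [[[x y] z] w]; rewrite /river_step /form_step /river_form.
have -> : pellQ x y + 2 * (x * z - p * y * w) + pellQ z w = pellQ (x + z) (y + w).
  by rewrite /pellQ; ring.
by case: ifP => _; congr (_, _, _); rewrite /pellQ; ring.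
Qed.

Lemma river_step_ok v : river_ok v -> river_ok (river_step v).
Proof.
move=> ok_v; have := river_form_ok ok_v.
case: v ok_v => [[[x y] z] w] [[x0 y0 z0 w0] det a0 c0] [_ _ Dp].
have nz : pellQ (x + z) (y + w) != 0.
  have -> : pellQ (x + z) (y + w) = pellQ x y + 2 * (x * z - p * y * w) + pellQ z w.
    by rewrite /pellQ; ring.
  (* If a + 2b + c = 0, then p = b^2 - a c = (a + b)^2. *)
  apply/eqP => E; have /eqP := p_nonsquare (pellQ x y + (x * z - p * y * w)).
  apply; rewrite -[RHS]Dp; move: E.
  by move: (pellQ x y) (x * z - _) (pellQ z w) => a b c E; have -> : c = - a - 2 * b by [lia]; ring.
rewrite /river_step; case: ifP => H; split=> //; try by split; lia.
- by nia.
- by nia.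
- by lia.
Qed.

(** For the image (A, B, C), the number A - 2B + C is the old a > 0 in the first branch and the old
    c < 0 in the second, so its sign reveals the branch. *)
Lemma form_step_inj f f' : form_ok f -> form_ok f' -> form_step f = form_step f' -> f = f'.
Proof.
case: f => [[a b] c]; case: f' => [[a' b'] c'] [a0 c0 _] [a0' c0' _] /=.
by case: ifP => H; case: ifP => H' [E1 E2 E3]; do ?congr pair; lia.
Qed.

(** Since a c < 0, p = b^2 + |a| |c| is a sum of nonnegative terms. *)
Lemma form_bounded a b c : form_ok (a, b, c) -> [/\ `|a| <= p, `|b| <= p & `|c| <= p].
Proof. by case=> a0 c0 E; split; nia. Qed.

Lemma river_period : 0 < p ->
  exists2 n, (0 < n)%N & river_form (iter n river_step (1, 0, 0, 1)) = (1, 0, - p).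
Proof.
move=> p0; pose v n := iter n river_step (1, 0, 0, 1).
have v0 : river_form (v 0%N) = (1, 0, - p) by rewrite /= /pellQ; congr (_, _, _); ring.
have ok n : river_ok (v n).
  elim: n => [|n IH]; last exact: river_step_ok.
  by split=> //; rewrite /pellQ; lia.
(* Coefficients lie in [-p, p]; shifting by p encodes them by 2p + 1 values, which makes the forms
   finite in number for the pigeonhole argument. *)
pose N := (absz p).*2.+1.
pose enc (t : int) : 'I_N := inord (absz (t + p)).
have encK t t' : `|t| <= p -> `|t'| <= p -> enc t = enc t' -> t = t'.
  by move=> Ht Ht' /(congr1 val); rewrite /= !inordK /N; lia.
pose code n := let: (a, b, c) := river_form (v n) in (enc a, enc b, enc c).
have codeK i j : code i = code j -> river_form (v i) = river_form (v j).
  rewrite /code; have := river_form_ok (ok i); have := river_form_ok (ok j).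
  case: (river_form (v i)) => [[a b] c]; case: (river_form (v j)) => [[a' b'] c'].
  move=> /form_bounded[? ? ?] /form_bounded[? ? ?] [E1 E2 E3].
  by congr (_, _, _); apply: encK.
have [i [j [lt_ij Eij]]] : exists i j : nat, (i < j)%N /\ code i = code j.
  have /injectivePn[i [j ne_ij Eij]] : ~~ injectiveb
      (fun i : 'I_(#|{: 'I_N * 'I_N * 'I_N}|.+1) => code i).
    apply/negP => /injectiveP /leq_card; by rewrite card_ord ltnn.
  by case: (ltngtP i j) => [lt|lt|/val_inj E]; [exists i, j | exists j, i | rewrite E eqxx in ne_ij].
exists (j - i)%N; first by rewrite subn_gt0.
rewrite -v0 -/(v _); move/codeK: Eij; rewrite -{1}(subnK (ltnW lt_ij)) addnC.
elim: i {lt_ij} (j - i)%N => [|i IH] n; first by rewrite add0n.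
rewrite addSn /v !iterS !river_form_step -/(v _) -/(v _) => /form_step_inj E.
by apply: IH; apply: E; apply: river_form_ok.
Qed.

Lemma pell_solution : 0 < p -> exists x y : int, [/\ 0 < y, 0 < x & x ^+ 2 - p * y ^+ 2 = 1].
Proof.
move=> p0; have [n n0 E] := river_period p0.
(* The sum of the entries grows at each step. This excludes the identity matrix, which y = 0 would
   force. *)
have : river_ok (iter n river_step (1, 0, 0, 1)) /\
    let: (x, y, z, w) := iter n river_step (1, 0, 0, 1) in n%:Z + 2 <= x + y + z + w.
  elim: n {n0 E} => [|n [IH1 IH2]].
    by split; [split=> //; rewrite /pellQ; lia | rewrite /=; lia].
  rewrite iterS; split; first exact: river_step_ok.
  move: IH1 IH2; case: (iter n _ _) => [[[x y] z] w] [[x0 y0 z0 w0] det _ _] H.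
  by rewrite /river_step; case: ifP => _; nia.
case: (iter n _ _) E => [[[x y] z] w] [Ea Eb Ec] [[[x0 y0 z0 w0] det _ _] H].
exists x, y; move: Ea; rewrite /pellQ => Ea; split=> //; last by nia.
rewrite lt0r y0 andbT; apply/eqP => y00; rewrite y00 in det Eb Ea.
have x1 : x = 1 by nia.
rewrite x1 in det Eb; have : z = 0 /\ w = 1 by split; lia.
by lia.
Qed.

End River.

Lemma prime_nonsquare p (t : int) : prime p -> t ^+ 2 != p%:Z.
Proof.
move=> pr_p; apply/eqP => /(congr1 absz); rewrite abszX absz_nat => E.
by have := congr1 (logn p) E; rewrite lognX (pfactorK 1 pr_p) /= => H; lia.
Qed.

(** For r = gcd (a, k): r^2 = gcd (a^2, a k, a b) = a gcd (a, k, b) = a. *)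
Lemma coprime_mul_square a b k : coprime a b -> (a * b = k ^ 2)%N -> exists r, a = (r ^ 2)%N.
Proof.
move=> co_ab E; exists (gcdn a k).
rewrite -mulnn muln_gcdl !muln_gcdr mulnn [(k * k)%N]mulnn -E -mulnn [(k * a)%N]mulnC.
rewrite -!muln_gcdr; suff /eqP -> : gcdn (gcdn a k) (gcdn k b) == 1%N by rewrite muln1.
rewrite -dvdn1 -(eqP co_ab) dvdn_gcd.
by rewrite (dvdn_trans (dvdn_gcdl _ _)) ?dvdn_gcdl // (dvdn_trans (dvdn_gcdr _ _)) ?dvdn_gcdr.
Qed.

Lemma coprime_split_prime q u v m : prime q -> coprime u v -> (u * v = q * m)%N ->
  (exists u', [/\ u = q * u', coprime u' v & u' * v = m])%N \/
  (exists v', [/\ v = q * v', coprime u v' & u * v' = m])%N.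
Proof.
move=> pr_q co E; have q0 := prime_gt0 pr_q.
have : (q %| u * v)%N by rewrite E dvdn_mulr.
rewrite Euclid_dvdM // => /orP[] /dvdnP[w Dw]; [left | right]; exists w; split.
- by rewrite mulnC.
- by move: co; rewrite Dw coprimeMl => /andP[].
- by apply/eqP; rewrite -(eqn_pmul2l q0) -E Dw; apply/eqP; ring.
- by rewrite mulnC.
- by move: co; rewrite Dw coprimeMr => /andP[].
- by apply/eqP; rewrite -(eqn_pmul2l q0) -E Dw; apply/eqP; ring.
Qed.

(* Descent: a solution of x^2 - p y^2 = 1 with x = 2 n + 1, y = 2 k gives n (n + 1) = p k^2, hence
   either a smaller solution or one of the negative equation. *)
Lemma negative_pell p : prime p -> (p %% 4 = 1)%N -> exists x y : int, x ^+ 2 + 1 = p%:Z * y ^+ 2.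
Proof.
move=> pr_p p4; have p0 := prime_gt0 pr_p.
have [x [y [y0 x0 E]]] := pell_solution (fun t => prime_nonsquare t pr_p) (p0 : 0 < p%:Z).
have {x x0 y y0 E} [x [y [y0 E]]] : exists x y : nat, (0 < y)%N /\ (x ^ 2 = p * y ^ 2 + 1)%N.
  by exists (absz x), (absz y); split; nia.
elim/ltn_ind: y x y0 E => y IH x y0 E.
have [n [k [Dx Dy]]] : exists n k, x = n.*2.+1 /\ y = k.*2.
  have par m : exists n, m = n.*2 \/ m = n.*2.+1 by exists m./2; lia.
  (* Modulo 4 the equation reads x^2 = y^2 + 1, so x is odd and y is even. *)
  have {p0 pr_p IH} [q Dq] : exists q, p = (4 * q + 1)%N by exists (p %/ 4)%N; lia.
  have [[n [] Dx] [k [] Dy]] := (par x, par y); subst; exists n, k; split=> //; nia.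
subst x y; have {}E : (n * n.+1 = p * k ^ 2)%N by nia.
have k0 : (0 < k)%N by lia.
case: (coprime_split_prime pr_p (coprimenS n) E) => [[n' [Dn co E']]|[n' [Dn co E']]].
  have [r Dr] := coprime_mul_square co E'.
  have [||s Ds] := @coprime_mul_square n.+1 n' k; [by rewrite coprime_sym | by rewrite -E' mulnC |].
  have r0 : (0 < r)%N by case: r Dr => // Dr; nia.
  apply: (IH r _ s) => //; first by nia.
  by rewrite -Ds Dn Dr; lia.
have [r Dr] := coprime_mul_square co E'.
have [||s Ds] := @coprime_mul_square n' n k; [by rewrite coprime_sym | by rewrite -E' mulnC |].
by exists r%:Z, s%:Z; move: Dn; rewrite Dr Ds; lia.
Qed.

(** The primes 2, p1, p2 are distributed over two coprime factors in eight ways; t is the factor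
    that does not receive p2, hence a square times a divisor of 2 p1. *)
Lemma consecutive_product p1 p2 n k : prime p1 -> prime p2 -> (n * n.+1 = 2 * p1 * p2 * k ^ 2)%N ->
  exists t r, (t = n \/ t = n.+1) /\
    [\/ t = p1 * r ^ 2, t = 2 * (p1 * r ^ 2), t = r ^ 2 | t = 2 * r ^ 2]%N.
Proof.
move=> pr1 pr2; rewrite -!mulnA => E.
suff H u v : coprime u v -> (u * v = 2 * (p1 * (p2 * k ^ 2)))%N -> exists t r,
    (t = u \/ t = v) /\ [\/ t = p1 * r ^ 2, t = 2 * (p1 * r ^ 2), t = r ^ 2 | t = 2 * r ^ 2]%N.
  exact: H (coprimenS n) E.
move=> {n E}.
have sq a b : coprime a b -> (a * b = k ^ 2)%N -> (exists r, a = r ^ 2)%N /\ (exists r, b = r ^ 2)%N.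
  move=> co E; split; first exact: coprime_mul_square E.
  by apply: (@coprime_mul_square b a k); [rewrite coprime_sym | rewrite mulnC].
move=> co /(coprime_split_prime (isT : prime 2) co) [][w [-> {}co]] /(coprime_split_prime pr1 co)
  [][w' [-> {}co]] /(coprime_split_prime pr2 co) [][w'' [-> {}co]] /(sq _ _ co) [[r ->] [s ->]].
- by exists (s ^ 2)%N, s; split; [right | constructor 3].
- by exists (2 * (p1 * r ^ 2))%N, r; split; [left | constructor 2].
- by exists (p1 * s ^ 2)%N, s; split; [right | constructor 1].
- by exists (2 * r ^ 2)%N, r; split; [left | constructor 4].
- by exists (2 * s ^ 2)%N, s; split; [right | constructor 4].
- by exists (p1 * r ^ 2)%N, r; split; [left | constructor 1].
- by exists (2 * (p1 * s ^ 2))%N, s; split; [right | constructor 2].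
- by exists (r ^ 2)%N, r; split; [left | constructor 3].
Qed.

(** * Ideals stable under conjugation *)

Section Ambiguous.

Variables (F : cset) (s : algC) (d : nat).
Hypothesis subF : is_subfield F.
Hypothesis F_i : F 'i.
Hypothesis F_s : F s.
Hypothesis F_quad : forall x, F x -> exists a b, [/\ Qi a, Qi b & x = a + b * s].
Hypothesis s_sqr : s ^+ 2 = d%:R.
Hypothesis s_notin_Qi : ~ Qi s.
Local Notation O := (ring_of_integers F).
Let sQ := Qi_subfield.

Definition conj_stable (J : cset) :=
  forall a b, Qi a -> Qi b -> J (a + b * s) -> J (a - b * s).

Lemma Qi_F x : Qi x -> F x.
Proof. by apply=> // g; rewrite inE => /eqP ->. Qed.

Lemma O_s : O s.
Proof. by split=> //; apply: Aint_sqr; rewrite s_sqr rpred_nat. Qed.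

Lemma Zi_in_O x : Zi x -> O x. Proof. exact: Zi_O. Qed.

Lemma O_Qi_Zi x : Qi x -> O x -> Zi x.
Proof. by move=> Qx [_]; apply: Qi_Aint. Qed.

Lemma s_indep u v : Qi u -> Qi v -> u + v * s = 0 -> v = 0.
Proof.
move=> Qu Qv E; apply/eqP; apply: contraT => v0; case: s_notin_Qi.
have -> : s = - u / v by apply: (mulIf v0); rewrite mulfVK // -[LHS]subr0 -E; ring.
exact: (sf_div sQ (sfN sQ Qu) Qv).
Qed.

Lemma O_conj_stable : conj_stable O.
Proof.
move=> a b Qa Qb [_ Ax]; split.
  by apply: (sfB subF); [|apply: (sfM subF) => //]; apply: Qi_F.
apply: Aint_conj_quad => //; rewrite s_sqr; exact: sf_nat.
Qed.

(** Membership of x in I means that x^2 / a is integral, and conjugation preserves this because a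
    lies in Q(i). *)
Lemma sqrt_ideal_conj_stable a I : Qi a -> sqrt_ideal F a I -> conj_stable I.
Proof.
move=> Qa sI u v Qu Qv Ix; have [iI _ a0 _] := sI.
apply: (sqrt_ideal_mem subF sI); first by apply: O_conj_stable => //; apply: (ideal_O iI).
have Qd : Qi d%:R by apply: sf_nat.
have Q1 : Qi ((u ^+ 2 + v ^+ 2 * d%:R) / a).
  exact: (sf_div sQ (sfD sQ (sfX sQ 2 Qu) (sfM sQ (sfX sQ 2 Qv) Qd)) Qa).
have Q2 : Qi (2 * u * v / a) by exact: (sf_div sQ (sfM sQ (sfM sQ (sf_nat sQ 2) Qu) Qv) Qa).
have -> : (u - v * s) ^+ 2 / a = (u ^+ 2 + v ^+ 2 * d%:R) / a - 2 * u * v / a * s.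
  by rewrite -s_sqr; field.
apply: O_conj_stable => //.
have -> : (u ^+ 2 + v ^+ 2 * d%:R) / a + 2 * u * v / a * s = (u + v * s) ^+ 2 / a.
  by rewrite -s_sqr; field.
exact: sqrt_ideal_sqr sI Ix.
Qed.

(* Writing J = c (Z[i] a + Z[i] (b + s)), stability under conjugation gives a | 2b, and
   a w = d - b^2.  With g = gcd (a, w) the number z = (b + s) / g is integral (its trace and norm
   lie in Z[i]), so J^2 = c^2 a g (a / g, z, w / g) = (c^2 a g). *)
Lemma conj_stable_sqrt_ideal J : (0 < d)%N -> is_ideal O J -> conj_stable J ->
  exists c a g, [/\ [/\ Zi a, Zi g, a != 0 & g != 0], O (c * a), sqrt_ideal F (c ^+ 2 * (a * g)) J,
    (exists2 a', Zi a' & (4 * d)%:R = a * a') & exists2 a', Zi a' & a = a' * g].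
Proof.
move=> d0 iJ sJ; have nd : d%:R != 0 :> algC by rewrite pnatr_eq0 -lt0n.
have Qd : Qi d%:R by apply: sf_nat.
have nz2d : 2 * d%:R != 0 :> algC by rewrite mulf_neq0 ?pnatr_eq0 // -lt0n.
pose A b := Qi b /\ exists2 a, Qi a & J (a + b * s).
(* The s-coefficients of J form a Z[i]-module of fractions. The factor 2d clears denominators: if x
   = a + b s has conjugate x', then 2 d b = (x - x') s is integral. *)
have [c [[Qc [b0 Qb0 Jx0]] c0 Hc]] : exists c, [/\ A c, c != 0 &
    forall b, A b -> exists2 q, Zi q & b = q * c].
  have [|||g [[c Ac Dg] g0 Hg]] := @Zi_pid (fun t => exists2 b, A b & t = 2 * d%:R * b).
  - move=> _ [b [Qb [a Qa Jx]] ->]; apply: Qi_Aint; first exact: (sfM sQ (sfM sQ (sf_nat sQ 2) Qd) Qb).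
    have [_ Ax] := ideal_O iJ Jx; have [_ Ax'] := ideal_O iJ (sJ _ _ Qa Qb Jx).
    have -> : 2 * d%:R * b = (a + b * s - (a - b * s)) * s by rewrite -s_sqr; ring.
    by apply: rpredM; [apply: rpredB | case: O_s].
  - move=> _ _ q [b [Qb [a Qa Jx]] ->] [b' [Qb' [a' Qa' Jx']] ->] Zq.
    have Qq := Zi_Qi Zq; exists (b - q * b'); last by ring.
    split; first exact: (sfB sQ Qb (sfM sQ Qq Qb')).
    exists (a - q * a'); first exact: (sfB sQ Qa (sfM sQ Qq Qa')).
    have -> : a - q * a' + (b - q * b') * s = (a + b * s) - q * (a' + b' * s) by ring.
    by apply: (idealB subF iJ) => //; apply: (idealM iJ) => //; apply: Zi_in_O.
  - have [_ [x [x0 Jx]]] := iJ; have [Fx _] := ideal_O iJ Jx.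
    have [a [b [Qa Qb Dx]]] := F_quad Fx.
    have [b0|nb] := eqVneq b 0; last first.
      exists (2 * d%:R * b); last by rewrite mulf_neq0.
      by exists b => //; split=> //; exists a; rewrite -?Dx.
    exists (2 * d%:R * a); last first.
      by rewrite mulf_neq0 //; apply: contraNneq x0 => a0; rewrite Dx a0 b0 mul0r addr0.
    exists a => //; split=> //; exists 0; first exact: sf0.
    have -> : 0 + a * s = s * x by rewrite Dx b0; ring.
    by apply: (idealM iJ) => //; exact: O_s.
  exists c; split=> //; first by apply: contraNneq g0 => c0; rewrite Dg c0 mulr0.
  move=> b Ab; have [|q Zq Dq] := Hg (2 * d%:R * b); first by exists b.
  by exists q => //; apply: (mulfI nz2d); rewrite Dq Dg; ring.
have [b Qb Db] : exists2 b, Qi b & b0 = c * b.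
  by exists (b0 / c); [exact: (sf_div sQ Qb0 Qc) | rewrite mulrC mulfVK].
subst b0; have Jy0 := sJ _ _ Qb0 Qc Jx0.
have [Ox0 Oy0] := (ideal_O iJ Jx0, ideal_O iJ Jy0).
have Nx0 : (c * b + c * s) * (c * b - c * s) = c ^+ 2 * (b ^+ 2 - d%:R) by rewrite -s_sqr; ring.
have nzN : b ^+ 2 - d%:R != 0.
  apply/eqP; rewrite -s_sqr subr_sqr => /eqP; rewrite mulf_eq0 => /orP[] /eqP E; case: s_notin_Qi.
    by have -> : s = b by rewrite -[LHS]add0r -E; ring.
  by have -> : s = - b by [rewrite -[LHS]subr0 -E; ring]; exact: (sfN sQ Qb).
have [a [[Qa Jca] a0 Ha]] : exists a, [/\ Qi a /\ J (c * a), a != 0 &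
    forall t, Qi t -> J (c * t) -> exists2 q, Zi q & t = q * a].
  have [|||g [[Qg Jg] g0 Hg]] := @Zi_pid (fun t => Qi t /\ J t).
  - by move=> t [Qt /(ideal_O iJ)]; apply: O_Qi_Zi.
  - move=> x y q [Qx Jx] [Qy Jy] Zq; split; first exact: (sfB sQ Qx (sfM sQ (Zi_Qi Zq) Qy)).
    by apply: (idealB subF iJ) => //; apply: (idealM iJ) => //; apply: Zi_in_O.
  - exists (c ^+ 2 * (b ^+ 2 - d%:R)); last by rewrite mulf_neq0 ?expf_neq0.
    split; first exact: (sfM sQ (sfX sQ 2 Qc) (sfB sQ (sfX sQ 2 Qb) Qd)).
    by rewrite -Nx0; apply: (idealM iJ).
  exists (g / c); split; [|by rewrite mulf_neq0 ?invr_eq0 |].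
    by split; [exact: (sf_div sQ Qg Qc) | rewrite mulrC mulfVK].
  move=> t Qt Jt; have [|q Zq Dq] := Hg (c * t); first by split=> //; exact: (sfM sQ Qc Qt).
  by exists q => //; apply: (mulfI c0); rewrite Dq mulrCA [c * _]mulrC mulfVK.
have HJ x : J x -> exists q r, [/\ Zi q, Zi r & x = q * (c * a) + r * (c * b + c * s)].
  move=> Jx; have [Fx _] := ideal_O iJ Jx; have [u [v [Qu Qv Dx]]] := F_quad Fx.
  have [|r Zr Dv] := Hc v; first by split=> //; exists u; rewrite -?Dx.
  have Qr := Zi_Qi Zr; have [||q Zq Dq] := Ha (u / c - r * b).
  - exact: (sfB sQ (sf_div sQ Qu Qc) (sfM sQ Qr Qb)).
  - have -> : c * (u / c - r * b) = x - r * (c * b + c * s) by rewrite Dx Dv; field.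
    by apply: (idealB subF iJ) => //; apply: (idealM iJ) => //; apply: Zi_in_O.
  exists q, r; split=> //; have -> : q * (c * a) = c * (u / c - r * b) by rewrite Dq; ring.
  by rewrite Dx Dv; field.
(* Expanding s (c a) in the basis c a, c (b + s) gives r = a from the coefficient of s and then q =
   - b. *)
have [Za Zb] : Zi a /\ Zi b.
  have [|q [r [Zq Zr E]]] := HJ (s * (c * a)); first by apply: (idealM iJ) => //; exact: O_s.
  have Er : r = a.
    have := @s_indep (q * a + r * b) (r - a) _ _ _; move=> /(_ _ _ _)/eqP; rewrite subr_eq0 => H.
    apply/eqP; apply: H.
    - exact: (sfD sQ (sfM sQ (Zi_Qi Zq) Qa) (sfM sQ (Zi_Qi Zr) Qb)).
    - exact: (sfB sQ (Zi_Qi Zr) Qa).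
    - by apply: (mulfI c0); rewrite mulr0 -(subrr (s * (c * a))) {1}E; ring.
  subst r; split=> //; suff -> : b = - q by exact: ZiN.
  apply: (mulfI a0); apply: (mulfI c0); apply/eqP; rewrite -subr_eq0.
  by apply/eqP; rewrite -(subrr (s * (c * a))) {1}E; ring.
have [w Zw Dw] : exists2 w, Zi w & d%:R - b ^+ 2 = w * a.
  apply: Ha; first exact: (sfB sQ Qd (sfX sQ 2 Qb)).
  have -> : c * (d%:R - b ^+ 2) = s * (c * b + c * s) - b * (c * b + c * s) by rewrite -s_sqr; ring.
  by apply: (idealB subF iJ); apply: (idealM iJ) => //; [exact: O_s | exact: Zi_in_O].
have [t Zt Dt] : exists2 t, Zi t & 2 * b = t * a.
  apply: Ha; first exact: (sfM sQ (sf_nat sQ 2) Qb).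
  have -> : c * (2 * b) = (c * b + c * s) + (c * b - c * s) by ring.
  exact: (idealD iJ).
have [g [u [v [a' [w' [[Zg Zu Zv] Za' Zw' Dg [Da Dw']]]]]]] := Zi_gcd Za Zw a0.
have g0 : g != 0 by apply: contraNneq a0 => g0; rewrite Da g0 mulr0.
pose z := (b + s) / g; have Dz : b + s = g * z by rewrite mulrC mulfVK.
have Oz : O z.
  split; first exact: (sf_div subF (sfD subF (Qi_F Qb) F_s) (Qi_F (Zi_Qi Zg))).
  apply: (@Aint_quadratic (t * a') (- (w' * a'))); [exact: ZiM | exact: (ZiN (ZiM Zw' Za')) |].
  apply: (mulfI (expf_neq0 2 g0)); rewrite -exprMn -Dz.
  have -> : g ^+ 2 * (t * a' * z - - (w' * a')) = (t * (a' * g)) * (g * z) + (w' * g) * (a' * g) by ring.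
  by rewrite -Da -Dw' -Dt -Dw -Dz -s_sqr; ring.
(* With g = u a + v w and a w = d - b^2, this puts the generator into J^2; stability enters because
   c (b - s) is needed as an element of J. *)
have Dn : c ^+ 2 * (a * g) = u * ((c * a) * (c * a)) - v * ((c * b + c * s) * (c * b - c * s)).
  by rewrite Nx0 Dg; have -> : b ^+ 2 - d%:R = - (w * a) by [rewrite -Dw; ring]; ring.
have iJJ := mul_ideal subF iJ iJ.
have JJn : ideal_mul O J J (c ^+ 2 * (a * g)).
  rewrite Dn; apply: (idealB subF iJJ); apply: (idealM iJJ); try exact: Zi_in_O; exact: mem_mul.
have On := ideal_O iJJ JJn.
exists c, a, g; split=> //; last by exists a'.
- exact: ideal_O iJ Jca.
- split=> //; first by rewrite !mulf_neq0 ?expf_neq0.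
  apply: set_eqE => x; rewrite principalE //; split; last by move=> [y Oy ->]; apply: (idealM iJJ).
  rewrite -[X in _ -> X]/((fun x => exists2 y, O y & x = y * (c ^+ 2 * (a * g))) x).
  move: x; apply: mul_sub.
    by rewrite -principalE //; apply: gen_mod_Omod => // _ ->.
  move=> _ _ /HJ[q [r [Zq Zr ->]]] /HJ[q' [r' [Zq' Zr' ->]]].
  (* From (b + s)^2 = 2b (b + s) + (d - b^2) = a (t (b + s) + w), the products a^2, a (b + s), (b +
     s)^2 are a g times a', z, t z + w'. *)
  exists (q * q' * a' + (q * r' + r * q') * z + r * r' * (t * z + w')).
    have ZO := Zi_in_O; apply: (OD subF); first apply: (OD subF).
    - exact: ZO (ZiM (ZiM Zq Zq') Za').
    - exact: (OM subF (ZO _ (ZiD (ZiM Zq Zr') (ZiM Zr Zq'))) Oz).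
    - exact: (OM subF (ZO _ (ZiM Zr Zr')) (OD subF (OM subF (ZO _ Zt) Oz) (ZO _ Zw'))).
  have -> : (q * (c * a) + r * (c * b + c * s)) * (q' * (c * a) + r' * (c * b + c * s)) =
    c ^+ 2 * (q * q' * a * a + (q * r' + r * q') * a * (b + s) + r * r' * (b + s) ^+ 2) by ring.
  have -> : (b + s) ^+ 2 = t * a * (b + s) + w * a by rewrite -Dt -Dw -s_sqr; ring.
  by rewrite Dz {2}Da Dw'; ring.
(* Here 4d = 4 (d - b^2) + (2b)^2, and a divides both d - b^2 and 2b. *)
exists (4 * w + t ^+ 2 * a).
  by apply: ZiD; [apply: ZiM => //; exact: Zi_nat | apply: ZiM => //; exact: ZiX].
have -> : a * (4 * w + t ^+ 2 * a) = 4 * (w * a) + (t * a) ^+ 2 by ring.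
by rewrite -Dw -Dt natrM; ring.
Qed.

End Ambiguous.

(** * Ideals whose squares are generated by divisors of 4d *)

Section SquareRootDivisors.

Variables (F : cset) (P : cset -> Prop).
Hypothesis subF : is_subfield F.
Hypothesis F_i : F 'i.
Local Notation O := (ring_of_integers F).

Definition sqrt_in_cls z := exists M, gen_cls O P M /\ sqrt_ideal F z M.

(** A property of all divisors at once, so that it can be built up prime by prime from units without
    a factorisation theorem. *)
Definition divisors_in_cls c :=
  [/\ Zi c, c != 0 & forall a b, Zi a -> Zi b -> c = a * b -> sqrt_in_cls a].

Lemma sqrt_in_cls_mul a b : sqrt_in_cls a -> sqrt_in_cls b -> sqrt_in_cls (a * b).
Proof.
move=> [M [gM sM]] [N [gN sN]]; exists (ideal_mul O M N).
by split; [apply: gen_cls_mul | apply: sqrt_ideal_mul].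
Qed.

Lemma divisors_in_cls_unit u : Zi u -> Zi u^-1 -> u != 0 -> divisors_in_cls u.
Proof.
move=> Zu Zv u0; split=> // a b Za Zb Du; exists (principal_ideal O 1); split.
  exact: gen_cls1.
have [a0 b0] : a != 0 /\ b != 0 by apply/andP; rewrite -negb_or -mulf_eq0 -Du.
apply: sqrt_ideal1 => //; split=> //; first exact: Zi_O.
have -> : a^-1 = b * u^-1 by rewrite Du; field; rewrite a0 b0.
by apply: Zi_O => //; apply: ZiM.
Qed.

(** Let a b = q c. Either q divides a and is split off, or u q + v a = 1 gives c = a (u b + v c), so
    a already divides c. *)
Lemma divisors_in_cls_prime q c : Zi_prime q -> sqrt_in_cls q -> divisors_in_cls c ->
  divisors_in_cls (q * c).
Proof.
move=> [Zq q0 Hq] gq [Zc c0 Hc]; split; [exact: ZiM | by rewrite mulf_neq0 |].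
move=> a b Za Zb E; have [[a' Za' Da]|[u [v [Zu Zv E1]]]] := Hq a Za.
  rewrite Da; apply: sqrt_in_cls_mul => //; apply: (Hc a' b) => //.
  by apply: (mulfI q0); rewrite E Da; ring.
apply: (Hc a (u * b + v * c)) => //; first by apply: ZiD; apply: ZiM.
transitivity (u * (q * c) + v * a * c); first by rewrite -[LHS]mul1r -E1; ring.
by rewrite E; ring.
Qed.

Lemma conj_stable_gen_cls s d I : F s -> (0 < d)%N ->
  (forall x, F x -> exists a b, [/\ Qi a, Qi b & x = a + b * s]) ->
  s ^+ 2 = d%:R -> ~ Qi s -> divisors_in_cls (4 * d)%:R ->
  gen_cls O (fun J => is_ideal O J /\ conj_stable s J) I -> gen_cls O P I.
Proof.
move=> Fs d0 Fquad Ds nQs [_ _ Hdiv]; apply: gen_cls_trans => // J _ [iJ sJ].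
have [c [a [g [[Za Zg a0 g0] Oca sqJ [a' Za' Da'] [g' Zg' Dg']]]]] :=
  conj_stable_sqrt_ideal subF F_i Fs Fquad Ds nQs d0 iJ sJ.
have [M [gM sM]] : sqrt_in_cls (a * g).
  apply: sqrt_in_cls_mul; first exact: (Hdiv a a').
  by apply: (Hdiv g (g' * a')) => //; [exact: ZiM | rewrite Da' Dg'; ring].
(* J^2 M^2 = (c^2 a g)(a g) is generated by the square of c a g, so J is inverse to M, which lies in
   the subgroup since a and g divide 4d. *)
apply: (gen_cls_sqrt subF sqJ sM gM (u := 1) (s := c * a * g)).
- by split; rewrite ?invr1 ?oner_neq0 //; exact: O1.
- by have [Fca _] := Oca; apply: (sfM subF Fca); case: (Zi_O subF F_i Zg).
- by ring.
Qed.

End SquareRootDivisors.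

(** * Gaussian primes above 2 and above p *)

Lemma conj_gauss e f : (gauss e f)^* = gauss e (- f).
Proof.
rewrite /gauss rmorphD !rmorphM /= !rmorph_int /= rmorph_nat conjCi rmorphN /=; ring.
Qed.

Lemma gauss_Zi e f : Zi (gauss e f).
Proof. by exists e, (2 * f); rewrite /gauss rmorphM /=; ring. Qed.

Lemma gauss_mul_conj p e f : p%:Z = e ^+ 2 + 4 * f ^+ 2 -> gauss e f * gauss e (- f) = p%:R.
Proof.
move=> Dp; rewrite pmulrn Dp rmorphD rmorphM !rmorphXn /= /gauss rmorphN /=.
by ring: (sqrCi algC).
Qed.

Lemma gauss_prime p e f : prime p -> p%:Z = e ^+ 2 + 4 * f ^+ 2 -> Zi_prime (gauss e f).
Proof.
by move=> pr_p Dp; apply: (Zi_prime_norm (gauss_Zi e f) _ pr_p); rewrite conj_gauss (gauss_mul_conj Dp).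
Qed.

Lemma sqr_1i : (1 + 'i) ^+ 2 = 2 * 'i :> algC.
Proof. by ring: (sqrCi algC). Qed.

Lemma Zi_1i : Zi (1 + 'i).
Proof. by exists 1, 1; rewrite mul1r. Qed.

Lemma one_plus_i_prime : Zi_prime (1 + 'i).
Proof.
apply: (@Zi_prime_norm _ 2) => //; first exact: Zi_1i.
by rewrite rmorphD rmorph1 /= conjCi; ring: (sqrCi algC).
Qed.

Lemma i_neq0 : 'i != 0 :> algC. Proof. exact: neq0Ci. Qed.

Lemma gen_field_trans gens F x : is_subfield F -> (forall g, g \in gens -> F g) ->
  gen_field gens x -> F x.
Proof. by move=> sF gF; apply. Qed.

(* If pi lies over p and p divides the norm of X, then pi or its conjugate divides X. *)
Lemma norm_factor (p k : nat) e f X : prime p -> p%:Z = e ^+ 2 + 4 * f ^+ 2 -> Zi X ->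
  X * X^* = (p * k)%:R ->
  exists f' z, [/\ f' = f \/ f' = - f, Zi z, X = gauss e f' * z & z * z^* = k%:R].
Proof.
move=> pr_p Dp ZX EX.
have nzp : p%:R != 0 :> algC by rewrite pnatr_eq0 -lt0n prime_gt0.
suff [f' [z [Hf Zz DX]]] : exists f' z, [/\ f' = f \/ f' = - f, Zi z & X = gauss e f' * z].
  exists f', z; split=> //; apply: (mulfI nzp); rewrite -natrM -EX DX rmorphM /= conj_gauss.
  have -> : p%:R = gauss e f' * gauss e (- f').
    by symmetry; apply: gauss_mul_conj; case: Hf => ->; rewrite ?sqrrN.
  by ring.
have [|[w Zw Dw]|[w Zw Dw]] := Zi_prime_dvd (gauss_prime pr_p Dp) ZX (Zi_conj ZX).
- exists (gauss e (- f) * k%:R); first by apply: ZiM; [exact: gauss_Zi | exact: Zi_nat].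
  by rewrite EX natrM -(gauss_mul_conj Dp); ring.
- by exists f, w; split; [left | | ].
- exists (- f), w^*; split; [by right | exact: Zi_conj |].
  by rewrite -conj_gauss -rmorphM /= -Dw conjCK.
Qed.

(** * Capitulation *)

Lemma absz_sqr_natr (y : int) : (absz y ^ 2)%:R = y%:~R ^+ 2 :> algC.
Proof. by rewrite pmulrn -rmorphXn /=; congr (_ %:~R); rewrite -abszX; lia. Qed.

Lemma pell_gauss p e f : prime p -> (p %% 4 = 1)%N -> p%:Z = e ^+ 2 + 4 * f ^+ 2 ->
  exists (x y : int) z, [/\ x ^+ 2 + 1 = p%:Z * y ^+ 2, Zi z, x%:~R + 'i = gauss e f * z &
    z * z^* = y%:~R ^+ 2].
Proof.
move=> pr_p p4 Dp; have [x [y E]] := negative_pell pr_p p4.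
have ZX : Zi (x%:~R + 'i) by exists x, 1; rewrite mul1r.
have conjX : (x%:~R + 'i)^* = x%:~R - 'i :> algC by rewrite rmorphD /= rmorph_int conjCi.
have [|f' [z [Hf Zz DX Nz]]] := @norm_factor p (absz y ^ 2)%N e f _ pr_p Dp ZX.
  rewrite conjX natrM absz_sqr_natr; transitivity ((x ^+ 2 + 1)%:~R : algC).
    by rewrite rmorphD rmorphXn /=; ring: (sqrCi algC).
  by rewrite E rmorphM rmorphXn.
rewrite absz_sqr_natr in Nz; case: Hf => Hf; subst f'; first by exists x, y, z.
(* If the conjugate of pi divides x + i, then pi divides x - i = - (- x + i), so x is replaced by -
   x. *)
exists (- x), y, (- z^*); split.
- by rewrite sqrrN.
- exact: (ZiN (Zi_conj Zz)).
- have := congr1 Num.conj DX; rewrite conjX rmorphM /= conj_gauss opprK mulrN => <-.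
  by rewrite rmorphN /=; ring.
- by rewrite rmorphN /= conjCK -Nz; ring.
Qed.

(* With x^2 + 1 = p y^2 and x + i = pi t s^2, the square of (x + i + y sqrt p) / ((1 + i) s) is
   pi times the unit - i t (x + y sqrt p). *)
Lemma gauss_capitulates F p e f r I : is_subfield F -> F 'i -> F r -> r ^+ 2 = p%:R ->
  prime p -> (p %% 4 = 1)%N -> p%:Z = e ^+ 2 + 4 * f ^+ 2 ->
  sqrt_ideal F (gauss e f) I -> is_principal (ring_of_integers F) I.
Proof.
move=> sF Fi Fr Dr pr_p p4 Dp sI.
have [x [y [z [E Zz DX Nz]]]] := pell_gauss pr_p p4 Dp.
have [x' Dx'] : exists x', x = 2 * x'.
  have {pr_p Dp Dr} [q Dq] : exists q, p%:Z = 4 * q + 1 by exists (p %/ 4)%N%:Z; lia.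
  move: E; rewrite Dq; have [x' [] ->] := int_parity x; first by exists x'.
  by have [y' [] ->] := int_parity y; lia.
have conjX : gauss e (- f) * z^* = x%:~R - 'i.
  by rewrite -conj_gauss -rmorphM /= -DX rmorphD /= rmorph_int conjCi.
have Ealg : x%:~R ^+ 2 + 1 = r ^+ 2 * y%:~R ^+ 2 :> algC.
  by rewrite Dr pmulrn -!rmorphXn -rmorphM -E rmorphD.
have X0 : x%:~R + 'i != 0 :> algC.
  apply/eqP => X0; have : (x ^+ 2 + 1)%:~R = (x%:~R + 'i) * (x%:~R - 'i) :> algC.
    by rewrite rmorphD rmorphXn /=; ring: (sqrCi algC).
  by rewrite X0 mul0r => /eqP; rewrite intr_eq0; nia.
have z0 : z != 0 by apply: contraNneq X0 => z0; rewrite DX z0 mulr0.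
have [|s [t [Zs Zt Zt' t0 Dz]]] := Zi_coprime_square Zz (Zi_conj Zz) (Zi_int y) z0 Nz.
  (* With x = 2x', the identity (x' - i)(x + i) - x' (x - i) = 1 makes z coprime to its
     conjugate. *)
  exists ((x'%:~R - 'i) * gauss e f), (- x'%:~R * gauss e (- f)); split.
  - by apply: ZiM (gauss_Zi _ _); apply: ZiB (Zi_int _) Zi_i.
  - by apply: ZiM (gauss_Zi _ _); apply: ZiN (Zi_int _).
  - by rewrite -!mulrA -DX conjX Dx' rmorphM /=; ring: (sqrCi algC).
have s0 : s != 0 by apply: contraNneq z0 => s0; rewrite Dz s0 expr0n mulr0.
pose eps := x%:~R + y%:~R * r; pose eps' := x%:~R - y%:~R * r.
have Ee : eps * eps' = -1.
  have -> : -1 = x%:~R ^+ 2 - r ^+ 2 * y%:~R ^+ 2 :> algC by rewrite -Ealg; ring.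
  by rewrite /eps /eps'; ring.
have Or : ring_of_integers F r by split=> //; apply: Aint_sqr; rewrite Dr rpred_nat.
have ZO u : Zi u -> ring_of_integers F u by apply: Zi_O.
have Oy := OM sF (O_int sF y) Or.
have Oe : ring_of_integers F eps := OD sF (O_int sF x) Oy.
have Oe' : ring_of_integers F eps' := OB sF (O_int sF x) Oy.
have e0 : eps != 0 by apply: contra_eq_neq Ee => ->; rewrite mul0r eq_sym oppr_eq0 oner_neq0.
have l0 : 1 + 'i != 0 :> algC by case: one_plus_i_prime.
pose b := (x%:~R + 'i + y%:~R * r) / ((1 + 'i) * s).
have Zit : Zi (- 'i * t) by apply: ZiM Zt; apply: ZiN Zi_i.
have uE : (- 'i * t * eps)^-1 = - 'i * t^-1 * eps'.
  have H : (- 'i * t * eps) * (- 'i * t^-1 * eps') = 1.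
    have -> : (- 'i * t * eps) * (- 'i * t^-1 * eps') = 'i ^+ 2 * (t * t^-1) * (eps * eps') by ring.
    by rewrite sqrCi mulfV // Ee; ring.
  have n0 : - 'i * t * eps != 0 by rewrite !mulf_neq0 ?oppr_eq0 ?i_neq0.
  by apply: (mulfI n0); rewrite H mulfV.
have Fb : F b.
  have [[Fx _] [Fy _] [Fs _]] := And3 (ZO _ (ZiD (Zi_int x) Zi_i)) Oy (ZO _ (ZiM Zi_1i Zs)).
  exact: (sf_div sF (sfD sF Fx Fy) Fs).
have Db : b ^+ 2 = - 'i * t * eps * gauss e f.
  apply: (mulIf (expf_neq0 2 (mulf_neq0 l0 s0))); rewrite -exprMn mulfVK ?mulf_neq0 //.
  have -> : (x%:~R + 'i + y%:~R * r) ^+ 2 = 2 * (x%:~R + 'i) * eps.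
    have -> : (x%:~R + 'i + y%:~R * r) ^+ 2 =
      (x%:~R + 'i) ^+ 2 + 2 * (x%:~R + 'i) * (y%:~R * r) + r ^+ 2 * y%:~R ^+ 2 by ring.
    by rewrite -Ealg /eps; ring: (sqrCi algC).
  by rewrite DX Dz exprMn sqr_1i; ring: (sqrCi algC).
exists b; split; last first.
  rewrite (sqrt_ideal_principal sF sI _ _ _ Fb Db) //.
  - exact: (OM sF (ZO _ Zit) Oe).
  - by rewrite !mulf_neq0 ?oppr_eq0 ?i_neq0.
  - by rewrite uE; apply: (OM sF _ Oe'); apply: ZO; apply: ZiM Zt'; apply: ZiN Zi_i.
apply: (O_sqr Fb); rewrite Db; apply: (OM sF); last by apply: ZO; exact: gauss_Zi.
exact: (OM sF (ZO _ Zit) Oe).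
Qed.

(** For zeta_8 = (1 + i) / sqrt 2, (1 - zeta_8)^2 = 1 + i - 2 zeta_8 = (1 - sqrt 2)(1 + i), and 1 -
    sqrt 2 is a unit. *)
Lemma one_plus_i_capitulates F I : is_subfield F -> F 'i -> F (sqrtC 2) ->
  sqrt_ideal F (1 + 'i) I -> is_principal (ring_of_integers F) I.
Proof.
move=> sF Fi F2 sI; have D2 := sqrtCK (2 : algC).
have nz2 : sqrtC 2 != 0 :> algC by rewrite sqrtC_eq0 pnatr_eq0.
have O2 : ring_of_integers F (sqrtC 2) by split=> //; apply: Aint_sqr; rewrite D2 rpred_nat.
pose b : algC := 1 - (1 + 'i) / sqrtC 2.
have Ou : ring_of_integers F (1 - sqrtC 2) := OB sF (O1 sF) O2.
have Ov : ring_of_integers F (- (1 + sqrtC 2)) := ON sF (OD sF (O1 sF) O2).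
have Euv : (1 - sqrtC 2) * - (1 + sqrtC 2) = 1 :> algC.
  have -> : (1 - sqrtC 2) * - (1 + sqrtC 2) = sqrtC 2 ^+ 2 - 1 :> algC by ring.
  by rewrite D2; ring.
have u0 : 1 - sqrtC 2 != 0 :> algC.
  by apply: contra_eq_neq Euv => ->; rewrite mul0r eq_sym oner_neq0.
have Dv : (1 - sqrtC 2)^-1 = - (1 + sqrtC 2) :> algC by apply: (mulfI u0); rewrite Euv mulfV.
have Fl : F (1 + 'i) := sfD sF (sf1 sF) Fi.
have Fb : F b := sfB sF (sf1 sF) (sf_div sF Fl F2).
have Db : b ^+ 2 = (1 - sqrtC 2) * (1 + 'i).
  apply: (mulIf (expf_neq0 2 nz2)).
  have -> : b ^+ 2 * sqrtC 2 ^+ 2 = (sqrtC 2 - (1 + 'i)) ^+ 2 by rewrite /b; field.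
  have -> : (sqrtC 2 - (1 + 'i)) ^+ 2 = sqrtC 2 ^+ 2 - 2 * sqrtC 2 * (1 + 'i) + (1 + 'i) ^+ 2 :> algC.
    by ring.
  by rewrite sqr_1i D2; ring.
have Ol := Zi_O sF Fi Zi_1i.
exists b; split; first by apply: (O_sqr Fb); rewrite Db; exact: OM.
by rewrite (sqrt_ideal_principal sF sI Ou u0 _ Fb Db) // Dv.
Qed.

(** * Relations coming from the fundamental unit *)

Lemma nonsquare_mul q m (t : int) : prime q -> ~~ (q %| m)%N -> t ^+ 2 != (q * m)%N%:Z.
Proof.
move=> pr_q ndvd; apply/eqP => /(congr1 absz); rewrite abszX absz_nat => E.
have m0 : (0 < m)%N by rewrite lt0n; apply: contraNneq ndvd => ->.
have := congr1 (logn q) E; rewrite lognX lognM ?(prime_gt0 pr_q) // (logn_prime q pr_q) eqxx.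
by rewrite [logn q m]lognE pr_q m0 (negbTE ndvd) /= => H; lia.
Qed.

Lemma rat_nonsquare (n : nat) (r : rat) : (forall t : int, t ^+ 2 != n%:Z) -> r ^+ 2 != n%:R.
Proof.
move=> ns; apply/eqP => E.
have Er : ratr r ^+ 2 = n%:R :> algC by rewrite -(ratr_nat _ n) -E rmorphXn.
have [t Dt] : exists t : int, ratr r = t%:~R :> algC.
  by apply: rat_Aint; apply: Aint_sqr; rewrite Er rpred_nat.
case/eqP: (ns t); apply: (@intr_inj algC).
by rewrite rmorphXn /= -Dt Er.
Qed.

Lemma sqrt_notin_Qi m : odd m -> ~ Qi (sqrtC (2 * m)%:R).
Proof.
move=> odd_m Qs; have Ds := sqrtCK ((2 * m)%:R : algC).
have [|a [b E]] := Qi_Aint Qs; first by apply: Aint_sqr; rewrite Ds rpred_nat.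
have Rs : (sqrtC (2 * m)%:R)^* = sqrtC (2 * m)%:R :> algC.
  by apply: conj_Creal; apply: ger0_real; rewrite sqrtC_ge0 ler0n.
have b0 : b%:~R = 0 :> algC.
  have := Rs; rewrite E conj_int_i => H.
  have: 2 * 'i * b%:~R = 0 :> algC by rewrite -(subrr (a%:~R + b%:~R * 'i)) -{2}H; ring.
  by move=> /eqP; rewrite !mulf_eq0 pnatr_eq0 (negbTE i_neq0) /= => /eqP.
have := @nonsquare_mul 2 m a isT; rewrite dvdn2 odd_m => /(_ isT)/eqP; apply.
by apply: (@intr_inj algC); rewrite rmorphXn /= -[RHS]Ds E b0 mul0r addr0.
Qed.

Lemma sqrtC_natM m n : sqrtC (m * n)%:R = sqrtC m%:R * sqrtC n%:R :> algC.
Proof. by rewrite natrM sqrtCM // qualifE /= ler0n. Qed.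

Lemma quad_fieldP d x : quad_field d x -> exists a b : rat, x = ratr a + ratr b * sqrtC d%:R.
Proof. by apply: (@gen_quadP _ d%:R); rewrite sqrtCK ratr_nat. Qed.

Lemma double_odd p1 p2 : odd p1 -> odd p2 -> exists q : int, (2 * p1 * p2)%N%:Z = 2 * (2 * q + 1).
Proof.
move=> odd1 odd2; have odd12 : odd (p1 * p2) by rewrite oddM odd1.
rewrite -mulnA; move: (p1 * p2)%N odd12 => m odd_m; exists m./2%:Z.
by have := odd_double_half m; rewrite odd_m; lia.
Qed.

(** For d = 2 mod 4 no half-integers occur in the ring of integers of Q(sqrt d): m^2 - d B^2 = 0 mod
    4 forces m and B to be even. *)
Lemma even_norm_form (m B n q : int) : m ^+ 2 - 2 * (2 * q + 1) * B ^+ 2 = 4 * n ->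
  exists x y, [/\ m = 2 * x, B = 2 * y & x ^+ 2 - 2 * (2 * q + 1) * y ^+ 2 = n].
Proof.
have [x [] ->] := int_parity m; have [y [] ->] := int_parity B => E; try by lia.
by exists x, y; split=> //; lia.
Qed.

(** The sum of two squares is the norm of (x + i) / (1 + i) = (a + 1) - a i. *)
Lemma sqrD1_eq_double (x y k : int) : x ^+ 2 - 2 * k * y ^+ 2 = -1 ->
  exists a, x = 2 * a + 1 /\ (a + 1) ^+ 2 + a ^+ 2 = k * y ^+ 2.
Proof.
have [a [] ->] := int_parity x => E; first by lia.
by exists a; split=> //; lia.
Qed.

(** The conjugate of eps is n / eps, integral because eps is a unit. So m = 2a and c = 2 d b are
    integers with c^2 = d (m^2 - 4n); as d is squarefree it divides c, and parity removes the
    remaining factor 2. *)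
Lemma quad_unit_int p1 p2 eps (n : int) : prime p1 -> prime p2 -> p1 != p2 -> odd p1 -> odd p2 ->
  `|n| = 1 -> unit_group (ring_of_integers (quad_field (2 * p1 * p2))) eps ->
  qnorm_is (2 * p1 * p2) eps n%:~R ->
  exists x y : int, eps = x%:~R + y%:~R * sk p1 p2 /\ x ^+ 2 - (2 * p1 * p2)%:Z * y ^+ 2 = n.
Proof.
move=> pr1 pr2 ne12 odd1 odd2 n1 [[_ Ae] e0 [_ Ae']] [a [b [De Nab]]].
rewrite /sk; set s := sqrtC _ in De *; set d := (2 * p1 * p2)%N in s De Nab *.
have Ds : s ^+ 2 = d%:R by apply: sqrtCK.
have As : s \in Aint by apply: Aint_sqr; rewrite Ds rpred_nat.
have Dc : ratr a - ratr b * s = n%:~R * eps^-1.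
  apply: (mulfI e0); rewrite mulrCA mulfV // mulr1 De -Nab -Ds; ring.
have Ac : ratr a - ratr b * s \in Aint by rewrite Dc rpredM ?Aint_int.
have [m Dm] : exists m : int, ratr (2 * a) = m%:~R :> algC.
  apply: rat_Aint; have -> : ratr (2 * a) = eps + (ratr a - ratr b * s).
    by rewrite De rmorphM /= ratr_nat; ring.
  exact: rpredD.
have [c Dc'] : exists m : int, ratr (2 * d%:R * b) = m%:~R :> algC.
  apply: rat_Aint; have -> : ratr (2 * d%:R * b) = (eps - (ratr a - ratr b * s)) * s.
    by rewrite De (rmorphM _ (2 * d%:R)) (rmorphM _ 2) /= !ratr_nat -Ds; ring.
  by apply: rpredM => //; apply: rpredB.
move/ratr_int_inj: Dm => Dm; move/ratr_int_inj: Dc' => Dc'.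
have Nrat : a ^+ 2 - d%:R * b ^+ 2 = n%:~R.
  by apply: (fmorph_inj (ratr : rat -> algC)); rewrite rmorphB (rmorphM _ d%:R) !rmorphXn /= ratr_nat ratr_int.
have Ec : c ^+ 2 = d%:Z * (m ^+ 2 - 4 * n).
  apply: (@intr_inj rat); rewrite (rmorphM _ d%:Z) rmorphB (rmorphM _ 4) !rmorphXn /= -Dm -Dc' -Nrat.
  by rewrite -pmulrn; ring.
have dvd_dc : (d %| absz c)%N.
  have dvd_q q : prime q -> (q %| d)%N -> (q %| absz c)%N.
    move=> pr_q qd; suff : (q %| absz c ^ 2)%N by rewrite Euclid_dvdX // => /andP[].
    by rewrite -abszX Ec abszM absz_nat dvdn_mulr.
  have co2 : coprime 2 p1 by rewrite coprime2n.
  have co : coprime (2 * p1) p2 by rewrite coprimeMl coprime2n odd2 prime_coprime // dvdn_prime2.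
  rewrite /d !Gauss_dvd // !dvd_q //; first by rewrite /d dvdn_mull.
    by rewrite /d mulnAC dvdn_mull.
  by rewrite /d -mulnA dvdn_mulr.
have [B DB] : exists B : int, c = d%:Z * B.
  by have /dvdzP[B ->] : (d%:Z %| c)%Z by []; exists B; rewrite mulrC.
have nd : (d%:R : rat) != 0 by rewrite pnatr_eq0 -lt0n /d !muln_gt0 !prime_gt0.
have Db : 2 * b = B%:~R.
  by apply: (mulfI nd); rewrite mulrA [_ * 2]mulrC Dc' DB rmorphM /= -pmulrn.
have EB : m ^+ 2 - d%:Z * B ^+ 2 = 4 * n.
  by apply: (@intr_inj rat); rewrite rmorphB (rmorphM _ d%:Z) (rmorphM _ 4) !rmorphXn /= -Dm -Db -Nrat -pmulrn; ring.
have [q Dd] := double_odd odd1 odd2.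
have [x [y [Dx Dy Exy]]] : exists x y, [/\ m = 2 * x, B = 2 * y & x ^+ 2 - d%:Z * y ^+ 2 = n].
  by move: EB; rewrite [d%:Z]Dd; apply: even_norm_form.
have two : (2 : rat) != 0 by [].
have Dax : a = x%:~R by apply: (mulfI two); rewrite Dm Dx rmorphM.
have Dby : b = y%:~R by apply: (mulfI two); rewrite Db Dy rmorphM.
by exists x, y; split=> //; rewrite De Dax Dby !ratr_int.
Qed.

Lemma ext_unit_group F F' u : (forall x, F x -> F' x) ->
  unit_group (ring_of_integers F) u -> unit_group (ring_of_integers F') u.
Proof. by move=> FF' [[Fu Au] u0 [Fv Av]]; split=> //; split=> //; apply: FF'. Qed.

Lemma unit_group_mul F u v : is_subfield F ->
  unit_group (ring_of_integers F) u -> unit_group (ring_of_integers F) v ->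
  unit_group (ring_of_integers F) (u * v).
Proof.
move=> sF [Ou u0 Ou'] [Ov v0 Ov']; split; [exact: OM | by rewrite mulf_neq0 |].
by rewrite invfM; apply: OM.
Qed.

Lemma Zi_unit_group F u : is_subfield F -> F 'i -> Zi u -> Zi u^-1 -> u != 0 ->
  unit_group (ring_of_integers F) u.
Proof. by move=> sF Fi Zu Zv u0; split=> //; apply: Zi_O. Qed.

Lemma mi_unit_group F : is_subfield F -> F 'i -> unit_group (ring_of_integers F) (- 'i).
Proof.
move=> sF Fi; apply: Zi_unit_group => //; first exact: (ZiN Zi_i).
  by rewrite invrN invCi opprK; exact: Zi_i.
by rewrite oppr_eq0 i_neq0.
Qed.

(* Since x^2 + 1 = 2 p1 p2 y^2, the Gaussian integer x + i is (1 + i) pi_a pi_b t s^2 with t a unit,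
   and (eps + i)^2 = 2 (x + i) eps. *)
Lemma norm_m1_relation F p1 p2 e f g h (x y : int) eps : is_subfield F -> F 'i ->
  prime p1 -> prime p2 -> p1%:Z = e ^+ 2 + 4 * f ^+ 2 -> p2%:Z = g ^+ 2 + 4 * h ^+ 2 ->
  odd p1 -> odd p2 ->
  unit_group (ring_of_integers F) eps ->
  eps = x%:~R + y%:~R * sk p1 p2 -> x ^+ 2 - (2 * p1 * p2)%:Z * y ^+ 2 = -1 ->
  exists f' h' u b, [/\ f' = f \/ f' = - f, h' = h \/ h' = - h,
    unit_group (ring_of_integers F) u, F b &
    b ^+ 2 = u * ((1 + 'i) * gauss e f' * gauss g h')].
Proof.
move=> sF Fi pr1 pr2 Dp1 Dp2 odd1 odd2 Ue De E.
have [a [Dx En]] : exists a, x = 2 * a + 1 /\ (a + 1) ^+ 2 + a ^+ 2 = p1%:Z * (p2%:Z * y ^+ 2).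
  by rewrite mulrA -PoszM; apply: sqrD1_eq_double; rewrite -PoszM mulnA.
pose X : algC := (a + 1)%:~R - a%:~R * 'i.
have ZX : Zi X by exists (a + 1), (- a); rewrite rmorphN /= /X; ring.
have cX : X^* = (a + 1)%:~R + a%:~R * 'i.
  by have := conj_int_i (a + 1) (- a); rewrite rmorphN /= mulNr opprK.
have NX : X * X^* = ((a + 1) ^+ 2 + a ^+ 2)%:~R.
  by rewrite cX /X (rmorphD _ ((a + 1) ^+ 2)) !rmorphXn /=; ring: (sqrCi algC).
have EX : X * X^* = (p1 * (p2 * absz y ^ 2))%:R.
  by rewrite NX En natrM (natrM _ p2) absz_sqr_natr !pmulrn -rmorphXn -!rmorphM.
have [f' [z1 [Hf Zz1 DX Nz1]]] := norm_factor pr1 Dp1 ZX EX.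
have [h' [z [Hh Zz Dz1 Nz]]] := norm_factor pr2 Dp2 Zz1 Nz1.
have Ny : z * z^* = y%:~R ^+ 2.
  by rewrite Nz absz_sqr_natr.
have X0 : X != 0.
  by rewrite -mul_conj_eq0 NX intr_eq0; clear; nia.
have z0 : z != 0 by apply: contraNneq X0 => z0; rewrite DX Dz1 z0 !mulr0.
have DXz : X = gauss e f' * gauss g h' * z by rewrite DX Dz1 mulrA.
have DcX : X^* = gauss e (- f') * gauss g (- h') * z^* by rewrite DXz !rmorphM /= !conj_gauss.
have [|s [t [Zs Zt Zt' t0 Dz]]] := Zi_coprime_square Zz (Zi_conj Zz) (Zi_int y) z0 Ny.
  (* (X^* - a) X - a X^* = (a + 1)^2 + a^2 - 2a (a + 1) = 1. *)
  exists ((X^* - a%:~R) * (gauss e f' * gauss g h')), (- a%:~R * (gauss e (- f') * gauss g (- h'))).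
  split.
  - by apply: ZiM; [apply: ZiB (Zi_conj ZX) (Zi_int a) | apply: ZiM; exact: gauss_Zi].
  - by apply: ZiM; [apply: ZiN (Zi_int a) | apply: ZiM; exact: gauss_Zi].
  - have assoc (t v w : algC) : t * v * w = t * (v * w) by rewrite mulrA.
    rewrite (assoc _ _ z) (assoc _ _ z^*) -DXz -DcX cX /X rmorphD /=.
    by ring: (sqrCi algC).
have s0 : s != 0 by apply: contraNneq z0 => s0; rewrite Dz s0 expr0n mulr0.
have l0 : 1 + 'i != 0 :> algC by case: one_plus_i_prime.
have Ds : sk p1 p2 ^+ 2 = (2 * p1 * p2)%:R := sqrtCK _.
(* The factor - i of the unit is 2 / (1 + i)^2. *)
exists f', h', (- 'i * t * eps), ((eps + 'i) / ((1 + 'i) * s)); split=> //.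
- apply: unit_group_mul => //; apply: unit_group_mul => //; first exact: mi_unit_group.
  exact: Zi_unit_group.
- have [[Fe _] _ _] := Ue; have [Fs _] := Zi_O sF Fi (ZiM Zi_1i Zs).
  exact: (sf_div sF (sfD sF Fe Fi) Fs).
apply: (mulIf (expf_neq0 2 (mulf_neq0 l0 s0))); rewrite -exprMn mulfVK ?mulf_neq0 //.
have -> : (eps + 'i) ^+ 2 = 2 * (x%:~R + 'i) * eps.
  have E' : (x%:~R ^+ 2 - (2 * p1 * p2)%:R * y%:~R ^+ 2 : algC) = -1.
    by rewrite pmulrn -!rmorphXn -rmorphM -rmorphB E.
  have H : y%:~R ^+ 2 * sk p1 p2 ^+ 2 = x%:~R ^+ 2 + 1.
    rewrite Ds; transitivity (x%:~R ^+ 2 - (x%:~R ^+ 2 - (2 * p1 * p2)%:R * y%:~R ^+ 2) : algC).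
      by ring.
    by rewrite E'; ring.
  have -> : (eps + 'i) ^+ 2 = (x%:~R + 'i) ^+ 2 + 2 * (x%:~R + 'i) * (y%:~R * sk p1 p2) +
    y%:~R ^+ 2 * sk p1 p2 ^+ 2 by rewrite De; ring.
  by rewrite H De; ring: (sqrCi algC).
have -> : x%:~R + 'i = (1 + 'i) * X by rewrite Dx /X !rmorphD rmorphM /=; ring: (sqrCi algC).
by rewrite DXz Dz exprMn sqr_1i; ring: (sqrCi algC).
Qed.

Lemma unit_group_inv F u : unit_group (ring_of_integers F) u -> unit_group (ring_of_integers F) u^-1.
Proof. by move=> [Ou u0 Ov]; split; rewrite ?invrK ?invr_eq0. Qed.

Lemma unit_group_div F u v : is_subfield F -> unit_group (ring_of_integers F) u ->
  unit_group (ring_of_integers F) v -> unit_group (ring_of_integers F) (u / v).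
Proof. by move=> sF Uu /unit_group_inv; apply: unit_group_mul. Qed.

Lemma unit_group_sqr F u v : is_subfield F -> F v -> v ^+ 2 = u ->
  unit_group (ring_of_integers F) u -> unit_group (ring_of_integers F) v.
Proof.
move=> sF Fv Dv [Ou u0 Ou']; have v0 : v != 0 by rewrite -sqrf_eq0 Dv.
split=> //; first by apply: O_sqr; rewrite ?Dv.
by apply: O_sqr; [exact: sfV | rewrite exprVn Dv].
Qed.

(** The single representative r need not be 1, so g is obtained as the quotient of g / r by 1 /
    r. *)
Lemma index1_sub (G H : cset) : index_is G H 1 -> G 1 -> (forall g, G g -> g != 0) ->
  (forall a b, H a -> H b -> H (a / b)) -> forall g, G g -> H g.
Proof.
move=> [r [Gr Hr]] G1 Gnz Hdiv g Gg; have r0 := Gnz _ (Gr ord0).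
have [i [Hi _]] := Hr _ G1; have [j [Hj _]] := Hr _ Gg.
rewrite (ord1 i) in Hi; rewrite (ord1 j) in Hj.
have -> : g = (g / tnth r ord0) / (1 / tnth r ord0) by field.
exact: Hdiv.
Qed.

Lemma rat_quad_indep (q : rat) (s : algC) : s ^+ 2 = ratr q -> (forall r : rat, r ^+ 2 != q) ->
  forall u v : rat, ratr u + ratr v * s = 0 -> u = 0 /\ v = 0.
Proof.
move=> Ds nq u v Euv; have v0 : v = 0.
  apply/eqP; apply: contraT => v0; case/eqP: (nq (u / v)).
  apply: (fmorph_inj (ratr : rat -> algC)); rewrite rmorphXn fmorph_div /= -Ds.
  have rv0 : ratr v != 0 :> algC by rewrite fmorph_eq0.
  have -> : s = - (ratr u / ratr v).
    by apply: (mulIf rv0); rewrite mulNr mulfVK // -[LHS]subr0 -Euv; ring.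
  by rewrite sqrrN.
by split=> //; move: Euv; rewrite v0 rmorph0 mul0r addr0 => /eqP; rewrite fmorph_eq0 => /eqP.
Qed.

(** If b + d sm is nonzero, then s2 = u + v sm with u, v rational. Squaring gives u v = 0, which
    makes 2 a square (v = 0) or 2m a square (u = 0). *)
Lemma biquadratic_indep (m : nat) (s2 sm : algC) (a b c d : rat) : s2 ^+ 2 = 2 -> sm ^+ 2 = m%:R ->
  (forall r : rat, r ^+ 2 != 2) -> (forall r : rat, r ^+ 2 != m%:R) ->
  (forall r : rat, r ^+ 2 != (2 * m)%:R) ->
  ratr a + ratr b * s2 + ratr c * sm + ratr d * (s2 * sm) = 0 -> b = 0 /\ c = 0.
Proof.
move=> D2 Dm n2 nm n2m E; have rDm : sm ^+ 2 = ratr m%:R by rewrite ratr_nat.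
have [t0|t0] := eqVneq (ratr b + ratr d * sm) 0.
  have [b0 d0] := rat_quad_indep rDm nm t0; split=> //.
  suff /(rat_quad_indep rDm nm) [] : ratr a + ratr c * sm = 0 by [].
  by rewrite -[RHS]E b0 d0 !rmorph0; ring.
have Km : (fun x => exists r : rat, x = ratr r) (sm ^+ 2) by exists m%:R.
have sK := quad_subfield Crat_subfield Km.
have inK (u v : rat) : exists x y : algC, [/\ exists r : rat, x = ratr r, exists r : rat, y = ratr r &
    ratr u + ratr v * sm = x + y * sm].
  by exists (ratr u), (ratr v); split=> //; [exists u | exists v].
have [_ [_ [[u ->] [v ->] Ds2]]] := sf_div sK (inK (- a) (- c)) (inK b d).
have {}Ds2 : s2 = ratr u + ratr v * sm.
  rewrite -Ds2; apply: (mulIf t0); rewrite mulfVK // !rmorphN -[RHS]addr0 -E; ring.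
have [] := @rat_quad_indep m%:R sm rDm nm (u ^+ 2 + v ^+ 2 * m%:R - 2) (2 * u * v).
  rewrite rmorphB rmorphD (rmorphM _ (v ^+ 2)) (rmorphM _ (2 * u)) (rmorphM _ 2 u) !rmorphXn /= !ratr_nat.
  by rewrite -[X in _ - X]D2 -Dm Ds2; ring.
move=> E1 /eqP; rewrite !mulf_eq0 /= => /orP[] /eqP z0.
  case/eqP: (n2m (v * m%:R)); rewrite natrM; have -> : 2 = v ^+ 2 * m%:R :> rat.
    by apply/eqP; rewrite eq_sym -subr_eq0 -[X in _ == X]E1 z0; apply/eqP; ring.
  by ring.
case/eqP: (n2 u); apply/eqP; rewrite -subr_eq0 -[X in _ == X]E1 z0; apply/eqP; ring.
Qed.

(** Such a v would be a unit, up to sign eps^n, and eps^(2n - 1) = 1 with an odd exponent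
    contradicts eps > 1. *)
Lemma fundamental_unit_not_sqr d eps v : fundamental_unit d eps -> quad_field d v -> v ^+ 2 <> eps.
Proof.
move=> [Ue e1 Hu] Fv Dv; have sF := gen_field_subfield [:: sqrtC (d%:R : algC)].
have [n Dn] := Hu v (unit_group_sqr sF Fv Dv Ue).
have e0 : eps != 0 by case: Ue.
have E : eps ^ (n * 2) = eps ^ 1.
  by rewrite expr1z -[RHS]Dv -exprz_exp -exprnP; case: Dn => ->; rewrite ?sqrrN.
have E1 : eps ^ (n * 2 - 1) = 1 by rewrite expfzDr // E expr1z exprN1 mulfV.
have := pexprz_eq1 (n * 2 - 1) (ltW (lt_trans ltr01 e1)); rewrite E1 eqxx (gt_eqF e1) orbF.
by lia.
Qed.

(** The square u^2 = b^2 n and its inverse are rational and integral, so b^2 n = 1 and (b n)^2 =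
    n. *)
Lemma unit_not_rat_multiple F (n : nat) (b : rat) s u : unit_group (ring_of_integers F) u ->
  s ^+ 2 = n%:R -> (forall r : rat, r ^+ 2 != n%:R) -> u <> ratr b * s.
Proof.
move=> [[_ Au] u0 [_ Av]] Ds nsq Du; pose q : rat := b ^+ 2 * n%:R.
have Dq : ratr q = u ^+ 2 :> algC by rewrite Du exprMn Ds (rmorphM _ (b ^+ 2)) rmorphXn /= ratr_nat.
have [t Dt] : exists t : int, ratr q = t%:~R :> algC by apply: (@rat_Aint q); rewrite Dq; apply: rpredX.
have [t' Dt'] : exists t : int, ratr q^-1 = t%:~R :> algC.
  have Dqv : ratr q^-1 = u^-1 ^+ 2 :> algC by rewrite exprVn -Dq fmorphV.
  by apply: (@rat_Aint q^-1); rewrite Dqv; apply: rpredX.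
move/ratr_int_inj: Dt => Dt; move/ratr_int_inj: Dt' => Dt'.
have q0 : q != 0.
  have : ratr q != 0 :> algC by rewrite Dq expf_neq0.
  by rewrite fmorph_eq0.
have tt' : t * t' = 1 by apply: (@intr_inj rat); rewrite rmorphM /= -Dt -Dt' mulfV.
have t0 : 0 <= t by rewrite -(ler0z rat) -Dt mulr_ge0 ?sqr_ge0 ?ler0n.
have t1 : t = 1 by move: t0 tt'; clear; move=> t0 tt'; have t'0 : 0 < t' by [nia]; nia.
by case/eqP: (nsq (b * n%:R)); rewrite exprMn [in LHS]expr2 mulrA -/q Dt t1 mul1r.
Qed.

(* If v^2 = 2 eps, then v / sqrt 2 is a unit u1 u2 u3; comparing coordinates of v / u3 in Q(sqrt d) and
   sqrt 2 u1 u2 makes u1 or u2 a rational multiple of a square root. *)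
Lemma unit_index1_not_sqr p1 p2 eps v : prime p1 -> prime p2 -> p1 != p2 -> odd p1 -> odd p2 ->
  unit_index_Q p1 p2 1 -> unit_group (ring_of_integers (quad_field (2 * p1 * p2))) eps ->
  quad_field (2 * p1 * p2) v -> v ^+ 2 <> 2 * eps.
Proof.
move=> pr1 pr2 ne12 odd1 odd2 ind1 Ue Fv Ev.
pose s2 : algC := sqrtC 2; pose sm : algC := sqrtC (p1 * p2)%:R.
have D2 : s2 ^+ 2 = 2 := sqrtCK _; have Dm : sm ^+ 2 = (p1 * p2)%:R := sqrtCK _.
have Dsk : sqrtC (2 * p1 * p2)%:R = s2 * sm by rewrite -mulnA sqrtC_natM.
have nz2 : s2 != 0 by rewrite sqrtC_eq0 pnatr_eq0.
have n2 (r : rat) : r ^+ 2 != 2.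
  by apply: (@rat_nonsquare 2) => t; apply: (@nonsquare_mul 2 1 t).
have nm (r : rat) : r ^+ 2 != (p1 * p2)%:R.
  by apply: rat_nonsquare => t; apply: nonsquare_mul => //; rewrite dvdn_prime2.
have n2m (r : rat) : r ^+ 2 != (2 * (p1 * p2))%:R.
  by apply: rat_nonsquare => t; apply: nonsquare_mul => //; rewrite dvdn2 oddM odd1 odd2.
have sK := gen_field_subfield [:: s2; sm].
have K2 : gen_field [:: s2; sm] s2 by apply: gen_field_gen; rewrite !inE eqxx.
have Km : gen_field [:: s2; sm] sm by apply: gen_field_gen; rewrite !inE eqxx orbT.
have qK x : quad_field (2 * p1 * p2) x -> gen_field [:: s2; sm] x.
  by apply: gen_field_trans => // g; rewrite inE => /eqP ->; rewrite Dsk; apply: (sfM sK).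
have sq d : is_subfield (quad_field d) := gen_field_subfield _.
have UK : unit_group (ring_of_integers (gen_field [:: s2; sm])) (v / s2).
  apply: (unit_group_sqr sK (sf_div sK (qK _ Fv) K2) _ (ext_unit_group qK Ue)).
  by rewrite expr_div_n Ev D2 mulrC mulKf ?pnatr_eq0.
have [|||u1 [u2 [u3 [U1 U2 U3 Dv]]]] := index1_sub ind1 _ _ _ UK.
- by split; rewrite ?invr1 ?oner_neq0 //; exact: (O1 sK).
- by move=> x [].
- move=> _ _ [a1 [a2 [a3 [A1 A2 A3 ->]]]] [b1 [b2 [b3 [B1 B2 B3 ->]]]].
  exists (a1 / b1), (a2 / b2), (a3 / b3); split; try exact: unit_group_div.
  by rewrite !invfM; ring.
have [[[F1 _] _ _] [[F2 _] _ _] [[F3 _] u30 _]] := And3 U1 U2 U3.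
have [a [b D1]] := quad_fieldP F1; have [c [e De]] := quad_fieldP F2.
have [P [R D3]] := quad_fieldP (sf_div (sq _) Fv F3).
rewrite -/s2 in D1; rewrite -/sm in De; rewrite Dsk in D3.
have Ev3 : v / u3 = s2 * u1 * u2.
  by apply: (mulIf u30); rewrite mulfVK // -[LHS](mulfVK nz2) Dv; ring.
(* In s2 (a + b s2)(c + e sm) the coordinate at s2 is a c, whereas v / u3 lies in Q(s2 sm) and has
   none. Hence a = 0 or c = 0. *)
have E : ratr (P - 2 * (b * c)) + ratr (- (a * c)) * s2 + ratr (- (2 * (b * e))) * sm +
    ratr (R - a * e) * (s2 * sm) = 0.
  rewrite !rmorphB !rmorphN (rmorphM _ 2) (rmorphM _ 2) (rmorphM _ b c) (rmorphM _ a c)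
    (rmorphM _ b e) (rmorphM _ a e) /= ratr_nat.
  have := Ev3; rewrite D3 D1 De => {}Ev3; rewrite -[RHS](subrr (ratr P + ratr R * (s2 * sm))) {2}Ev3 -D2.
  by ring.
have [/eqP ac0 /eqP be0] := biquadratic_indep D2 Dm n2 nm n2m E.
move: ac0; rewrite oppr_eq0 mulf_eq0 => /orP[] /eqP z0.
  apply: (unit_not_rat_multiple U1 D2 n2 (b := b)).
  by rewrite D1 z0 rmorph0 add0r.
apply: (unit_not_rat_multiple U2 Dm nm (b := e)).
by rewrite De z0 rmorph0 add0r.
Qed.

Lemma sqrB1_eq_double (x y q : int) : 1 < x -> x ^+ 2 - 2 * (2 * q + 1) * y ^+ 2 = 1 ->
  exists n k : nat, [/\ x = 2 * n%:Z + 1, (0 < n)%N & n%:Z * n.+1%:Z = 2 * (2 * q + 1) * k%:Z ^+ 2].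
Proof.
have [n [] ->] := int_parity x => x1; first by lia.
have [k [] ->] := int_parity y => E; last by lia.
by exists (absz n), (absz k); split; nia.
Qed.

(* x^2 - 1 = d y^2 splits as n (n + 1) = 2 p1 p2 k^2 with x = 2 n + 1, and (eps +- 1)^2 = 4 t eps
   for t = n + 1, n; the factorisations where p1 and p2 are not separated would make eps or
   2 eps a square in Q(sqrt d), which contradicts minimality of eps, respectively Q = 1. *)
Lemma norm_1_relation F p1 p2 (x y : int) eps : is_subfield F -> F 'i -> F (sk p1 p2) ->
  prime p1 -> prime p2 -> p1 != p2 -> odd p1 -> odd p2 ->
  fundamental_unit (2 * p1 * p2) eps -> unit_index_Q p1 p2 1 ->
  eps = x%:~R + y%:~R * sk p1 p2 -> x ^+ 2 - (2 * p1 * p2)%:Z * y ^+ 2 = 1 ->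
  exists u b, [/\ unit_group (ring_of_integers F) u, F b & b ^+ 2 = u * p1%:R].
Proof.
move=> sF Fi Fs pr1 pr2 ne12 odd1 odd2 fund ind1 De E.
have [Ue e1 _] := fund; have [_ e0 _] := Ue; have sq : is_subfield (quad_field (2 * p1 * p2)) := gen_field_subfield _.
have qF z : quad_field (2 * p1 * p2) z -> F z.
  by apply: gen_field_trans => // g; rewrite inE => /eqP ->.
have Ds : sk p1 p2 ^+ 2 = (2 * p1 * p2)%:R := sqrtCK _.
have E' : x%:~R ^+ 2 - (2 * p1 * p2)%:R * y%:~R ^+ 2 = 1 :> algC.
  by rewrite pmulrn -!rmorphXn -rmorphM -rmorphB E.
have Dinv : eps^-1 = x%:~R - y%:~R * sk p1 p2.
  by apply: (mulfI e0); rewrite mulfV // -[LHS]E' -Ds De; ring.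
have esq : eps ^+ 2 = 2 * x%:~R * eps - 1.
  have -> : 2 * x%:~R = eps + eps^-1 by rewrite Dinv De; ring.
  by rewrite mulrDl mulVf //; ring.
have x1 : 1 < x.
  have x0 : 0 < x.
    have : 0 < 2 * x%:~R :> algC.
      have -> : 2 * x%:~R = eps + eps^-1 by rewrite Dinv De; ring.
      by rewrite addr_gt0 ?invr_gt0 // (lt_trans ltr01 e1).
    by rewrite pmulr_rgt0 ?ltr0n // ltr0z.
  have d0 : 0 < (2 * p1 * p2)%:Z by rewrite ltz_nat !muln_gt0 !prime_gt0.
  have [//|x2] := ltP 1 x; have Dx : x = 1 by lia.
  have y0 : y = 0 by move: E d0; rewrite Dx; move: (_%:Z) => d; nia.
  by move: e1; rewrite De Dx y0 mul0r addr0 ltxx.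
have [q Dd] := double_odd odd1 odd2.
have [n [k [Dx n0 Enk]]] : exists n k : nat, [/\ x = 2 * n%:Z + 1, (0 < n)%N &
    (n * n.+1 = 2 * p1 * p2 * k ^ 2)%N].
  have [|n [k [Dx n0 Enk]]] := @sqrB1_eq_double x y q x1; first by rewrite -Dd.
  by exists n, k; split=> //; move: Enk; rewrite -Dd -!PoszM => /eqP; rewrite eqz_nat -mulnn => /eqP.
have [t [r [Ht Hr]]] := consecutive_product pr1 pr2 Enk.
(* For tau = 1 or -1, eps^2 + 1 = 2 x eps gives (eps + tau)^2 = 2 (x + tau) eps, and x + tau is 2 (n
   + 1) or 2n. *)
have [tau [Ftau Esq]] : exists tau, quad_field (2 * p1 * p2) tau /\
    (eps + tau) ^+ 2 = 4 * t%:R * eps.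
  have xE : x%:~R = 2 * n%:R + 1 :> algC by rewrite Dx rmorphD rmorphM.
  case: Ht => ->; [exists (-1) | exists 1]; split.
  - exact: (sfN sq (sf1 sq)).
  - by rewrite sqrrD esq xE; ring.
  - exact: (sf1 sq).
  - by rewrite sqrrD esq xE -natr1; ring.
have t0 : (0 < t)%N by case: Ht => ->.
have [[Fe _] _ _] := Ue; have Fw := sfD sq Fe Ftau.
have F2r := sfM sq (sf_nat sq 2) (sf_nat sq r).
have r0 : r%:R != 0 :> algC.
  by rewrite pnatr_eq0; apply: contraTneq t0 => r00; case: Hr => ->; rewrite r00 exp0n // !muln0.
have nz2 : 2 != 0 :> algC by rewrite pnatr_eq0.
have n2r : 2 * r%:R != 0 :> algC by rewrite mulf_neq0.
have l0 : 1 + 'i != 0 :> algC by case: one_plus_i_prime.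
have UeF := ext_unit_group qF Ue.
case: Hr => Dt; rewrite Dt ?(natrM _ 2) ?(natrM _ p1) natrX in Esq.
- exists eps, ((eps + tau) / (2 * r%:R)); split=> //; first exact: qF (sf_div sq Fw F2r).
  by rewrite expr_div_n Esq; field.
(* The extra factor 2 is absorbed by 2 = - i (1 + i)^2, which requires i in F. *)
- exists (- 'i * eps), ((eps + tau) / (2 * r%:R) / (1 + 'i)); split.
  + by apply: unit_group_mul => //; apply: mi_unit_group.
  + exact: (sf_div sF (qF _ (sf_div sq Fw F2r)) (sfD sF (sf1 sF) Fi)).
  + rewrite !expr_div_n Esq sqr_1i; apply: (mulIf i_neq0); field: (sqrCi algC).
    by rewrite r0 i_neq0.
- case: (fundamental_unit_not_sqr fund (sf_div sq Fw F2r)).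
  by rewrite expr_div_n Esq; field.
- case: (unit_index1_not_sqr pr1 pr2 ne12 odd1 odd2 ind1 Ue (sf_div sq Fw F2r)).
  by rewrite expr_div_n Esq; field.
Qed.

(** * The ideals H_j, the genus field and the three cases *)

Lemma sqrt_ideal_of_set_eq F q H : is_subfield F -> F 'i -> Zi_prime q ->
  is_ideal (ring_of_integers F) H ->
  set_eq (ideal_mul (ring_of_integers F) H H) (principal_ideal (ring_of_integers F) q) ->
  sqrt_ideal F q H.
Proof.
by move=> sF Fi [Zq q0 _] iH /set_eqE E; split=> //; apply: Zi_O.
Qed.

Lemma odd_of_mod4 p : (p %% 4 = 1)%N -> odd p.
Proof. by move=> p4; have := odd_double_half p; case: (odd p) => //=; lia. Qed.

Lemma gauss_prime_neg p (a b : int) : prime p -> p%:Z = a ^+ 2 + 4 * b ^+ 2 -> Zi_prime (gauss a (- b)).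
Proof. by move=> pr_p Dp; apply: (gauss_prime pr_p); rewrite sqrrN. Qed.

Section GenusField.

Variables (p1 p2 : nat) (e f g h : int) (H0 H1 H2 H3 H4 : cset).
Hypotheses (pr1 : prime p1) (pr2 : prime p2) (mod1 : (p1 %% 4 = 1)%N) (mod2 : (p2 %% 4 = 1)%N).
Hypotheses (Dp1 : p1%:Z = e ^+ 2 + 4 * f ^+ 2) (Dp2 : p2%:Z = g ^+ 2 + 4 * h ^+ 2).

Local Notation K := (kfield p1 p2).

Hypothesis sq0 : sqrt_ideal K (1 + 'i) H0.
Hypothesis sq1 : sqrt_ideal K (gauss e f) H1.
Hypothesis sq2 : sqrt_ideal K (gauss e (- f)) H2.
Hypothesis sq3 : sqrt_ideal K (gauss g h) H3.
Hypothesis sq4 : sqrt_ideal K (gauss g (- h)) H4.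

Lemma k_subfield : is_subfield K. Proof. exact: gen_field_subfield. Qed.

Lemma k_i : K 'i. Proof. by apply: gen_field_gen; rewrite !inE eqxx orbT. Qed.

Lemma k_sk : K (sk p1 p2). Proof. by apply: gen_field_gen; rewrite !inE eqxx. Qed.

Lemma sk_sqr : sk p1 p2 ^+ 2 = (2 * p1 * p2)%:R. Proof. exact: sqrtCK. Qed.

Lemma sk_notin_Qi : ~ Qi (sk p1 p2).
Proof.
by rewrite /sk -mulnA; apply: sqrt_notin_Qi; rewrite oddM !odd_of_mod4.
Qed.

Lemma k_quad x : K x -> exists a b, [/\ Qi a, Qi b & x = a + b * sk p1 p2].
Proof. by apply: gen_quad_iP; rewrite sk_sqr; apply: (sf_nat Qi_subfield). Qed.

(** The disjunction lets one argument produce H4 from H3 and H3 from H4; the case of norm -1 needs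
    both directions. *)
Lemma product_relation P a b H H' : (a = h /\ H = H3 /\ H' = H4) \/ (a = - h /\ H = H4 /\ H' = H3) ->
  gen_cls (Ok p1 p2) P H1 -> gen_cls (Ok p1 p2) P H2 -> gen_cls (Ok p1 p2) P H ->
  b = - a -> gen_cls (Ok p1 p2) P H'.
Proof.
move=> Hab g1 g2 gH Db; have sF := k_subfield.
have [sH [sH' Dab]] : sqrt_ideal K (gauss g a) H /\ sqrt_ideal K (gauss g b) H' /\
    gauss g a * gauss g b = p2%:R.
  rewrite Db; case: Hab => -[-> [-> ->]]; rewrite ?opprK; split=> //; split=> //.
    exact: gauss_mul_conj.
  by rewrite mulrC; apply: gauss_mul_conj.
apply: (gen_cls_sqrt sF sH' (sqrt_ideal_mul sF sq1 (sqrt_ideal_mul sF sq2 sH))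
  (gen_cls_mul sF g1 (gen_cls_mul sF g2 gH)) (mi_unit_group sF k_i)
  (sf_div sF k_sk (sfD sF (sf1 sF) k_i))).
rewrite expr_div_n sk_sqr sqr_1i.
have -> : gauss g b * (gauss e f * (gauss e (- f) * gauss g a)) = p1%:R * p2%:R.
  by rewrite -Dab -(gauss_mul_conj Dp1); ring.
rewrite !natrM; apply: (mulIf i_neq0); field: (sqrCi algC).
by rewrite i_neq0.
Qed.

Lemma Ams_sub P I : gen_cls (Ok p1 p2) P H0 -> gen_cls (Ok p1 p2) P H1 ->
  gen_cls (Ok p1 p2) P H2 -> gen_cls (Ok p1 p2) P H3 -> gen_cls (Ok p1 p2) P H4 ->
  in_Ams p1 p2 I -> gen_cls (Ok p1 p2) P I.
Proof.
move=> g0 g1 g2 g3 g4; have sF := k_subfield.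
apply: (conj_stable_gen_cls (P := P) sF k_i k_sk _ k_quad sk_sqr sk_notin_Qi).
  by rewrite !muln_gt0 !prime_gt0.
pose l : algC := 1 + 'i.
(* The rational integer 8 equals (1 + i)^6 i, since (1 + i)^6 = (2 i)^3 = - 8 i. *)
have -> : (4 * (2 * p1 * p2))%:R = l * (l * (l * (l * (l * (l * (gauss e f * (gauss e (- f) *
    (gauss g h * (gauss g (- h) * 'i))))))))).
  transitivity ((l ^+ 2) ^+ 3 * (gauss e f * gauss e (- f)) * (gauss g h * gauss g (- h)) * 'i).
    rewrite sqr_1i (gauss_mul_conj Dp1) (gauss_mul_conj Dp2) !natrM.
    by ring: (sqrCi algC).
  by ring.
have sqc q H : sqrt_ideal K q H -> gen_cls (Ok p1 p2) P H -> sqrt_in_cls K P q.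
  by move=> sH gH; exists H.
have pm := one_plus_i_prime.
do 6!apply: (divisors_in_cls_prime sF pm (sqc _ _ sq0 g0)).
apply: (divisors_in_cls_prime sF (gauss_prime pr1 Dp1) (sqc _ _ sq1 g1)).
apply: (divisors_in_cls_prime sF (gauss_prime_neg pr1 Dp1) (sqc _ _ sq2 g2)).
apply: (divisors_in_cls_prime sF (gauss_prime pr2 Dp2) (sqc _ _ sq3 g3)).
apply: (divisors_in_cls_prime sF (gauss_prime_neg pr2 Dp2) (sqc _ _ sq4 g4)).
apply: (divisors_in_cls_unit P sF k_i Zi_i _ i_neq0).
by rewrite invCi; exact: (ZiN Zi_i).
Qed.

Lemma sqrt_ideal_ambiguous q H : Zi q -> sqrt_ideal K q H -> ambiguous_ideal p1 p2 H.
Proof.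
move=> Zq sH; split; first by case: sH.
exact: (sqrt_ideal_conj_stable k_subfield k_i k_sk sk_sqr sk_notin_Qi (Zi_Qi Zq) sH).
Qed.

(** The common part of the three cases. Generators are drawn from H0, ..., H3, so capitulation is
    checked only there; each case supplies the missing classes by relations. *)
Lemma Ams_result_of (gens : cset -> Prop) :
  (forall J, gens J -> [\/ J = H0, J = H1, J = H2 | J = H3]) ->
  gen_cls (Ok p1 p2) gens H0 -> gen_cls (Ok p1 p2) gens H1 -> gen_cls (Ok p1 p2) gens H2 ->
  gen_cls (Ok p1 p2) gens H3 -> gen_cls (Ok p1 p2) gens H4 -> Ams_result p1 p2 gens.
Proof.
move=> Hgens g0 g1 g2 g3 g4; have sF := k_subfield.
have AG I : in_Ams p1 p2 I -> gen_cls (Ok p1 p2) gens I by apply: Ams_sub.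
split=> I.
  move=> _; split; first exact: AG.
  apply: gen_cls_trans => // J iJ /Hgens HJ; apply: gen_cls_mem => //.
  by case: HJ => ->; [exact: sqrt_ideal_ambiguous Zi_1i sq0
    | exact: sqrt_ideal_ambiguous (gauss_Zi _ _) sq1
    | exact: sqrt_ideal_ambiguous (gauss_Zi _ _) sq2
    | exact: sqrt_ideal_ambiguous (gauss_Zi _ _) sq3].
move/AG; pose gs := [:: sqrtC 2; sqrtC p1%:R; sqrtC p2%:R; 'i : algC].
have sF' : is_subfield (gen_field gs) := gen_field_subfield _.
have mem x : x \in gs -> gen_field gs x by exact: gen_field_gen.
have [m2 [mp1 [mp2 mi]]] : gen_field gs (sqrtC 2) /\ gen_field gs (sqrtC p1%:R) /\
    gen_field gs (sqrtC p2%:R) /\ gen_field gs 'i.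
  by do !split; apply: mem; rewrite !inE eqxx ?orbT.
have FF' x : K x -> gen_field gs x.
  apply: gen_field_trans => // y; rewrite !inE => /orP[] /eqP -> //.
  by rewrite /sk !sqrtC_natM; exact: (sfM sF' (sfM sF' m2 mp1) mp2).
apply: (gen_cls_capitulates sF sF' FF') => J iJ /Hgens[] ->.
- exact: one_plus_i_capitulates sF' mi m2 (ext_sqrt sF sF' FF' sq0).
- exact: gauss_capitulates sF' mi mp1 (sqrtCK _) pr1 mod1 Dp1 (ext_sqrt sF sF' FF' sq1).
- apply: gauss_capitulates sF' mi mp1 (sqrtCK _) pr1 mod1 _ (ext_sqrt sF sF' FF' sq2).
  by rewrite sqrrN.
- exact: gauss_capitulates sF' mi mp2 (sqrtCK _) pr2 mod2 Dp2 (ext_sqrt sF sF' FF' sq3).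
Qed.

End GenusField.

Theorem theorem47 (p1 p2 : nat) (e f g h : int) (eps3 : algC)
    (H0 H1 H2 H3 H4 : cset) :
  prime p1 -> prime p2 -> p1 != p2 -> (p1 %% 4 = 1)%N -> (p2 %% 4 = 1)%N ->
  p1%:Z = e ^+ 2 + 4 * f ^+ 2 -> p2%:Z = g ^+ 2 + 4 * h ^+ 2 ->
  fundamental_unit (2 * p1 * p2) eps3 ->
  is_ideal (Ok p1 p2) H0 -> is_ideal (Ok p1 p2) H1 -> is_ideal (Ok p1 p2) H2 ->
  is_ideal (Ok p1 p2) H3 -> is_ideal (Ok p1 p2) H4 ->
  set_eq (ideal_mul (Ok p1 p2) H0 H0) (principal_ideal (Ok p1 p2) (1 + 'i)) ->
  set_eq (ideal_mul (Ok p1 p2) H1 H1) (principal_ideal (Ok p1 p2) (gauss e f)) ->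
  set_eq (ideal_mul (Ok p1 p2) H2 H2) (principal_ideal (Ok p1 p2) (gauss e (- f))) ->
  set_eq (ideal_mul (Ok p1 p2) H3 H3) (principal_ideal (Ok p1 p2) (gauss g h)) ->
  set_eq (ideal_mul (Ok p1 p2) H4 H4) (principal_ideal (Ok p1 p2) (gauss g (- h))) ->
  (qnorm_is (2 * p1 * p2) eps3 (-1) ->
     Ams_result p1 p2 (fun J => [\/ J = H0, J = H1 | J = H2])) /\
  (qnorm_is (2 * p1 * p2) eps3 1 ->
     (unit_index_Q p1 p2 2 ->
        Ams_result p1 p2 (fun J => [\/ J = H0, J = H1, J = H2 | J = H3])) /\
     (unit_index_Q p1 p2 1 ->
        Ams_result p1 p2 (fun J => [\/ J = H0, J = H1 | J = H3]))).
Proof.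
move=> pr1 pr2 ne12 mod1 mod2 Dp1 Dp2 fund i0 i1 i2 i3 i4 E0 E1 E2 E3 E4.
have [sF Fi] := (@k_subfield p1 p2, @k_i p1 p2); have [Ue _ _] := fund.
have [odd1 odd2] := (odd_of_mod4 mod1, odd_of_mod4 mod2).
have sq0 := sqrt_ideal_of_set_eq sF Fi one_plus_i_prime i0 E0.
have sq1 := sqrt_ideal_of_set_eq sF Fi (gauss_prime pr1 Dp1) i1 E1.
have sq2 := sqrt_ideal_of_set_eq sF Fi (gauss_prime_neg pr1 Dp1) i2 E2.
have sq3 := sqrt_ideal_of_set_eq sF Fi (gauss_prime pr2 Dp2) i3 E3.
have sq4 := sqrt_ideal_of_set_eq sF Fi (gauss_prime_neg pr2 Dp2) i4 E4.
have result := Ams_result_of pr1 pr2 mod1 mod2 Dp1 Dp2 sq0 sq1 sq2 sq3 sq4.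
have rel34 P : gen_cls (Ok p1 p2) P H1 -> gen_cls (Ok p1 p2) P H2 ->
    gen_cls (Ok p1 p2) P H3 -> gen_cls (Ok p1 p2) P H4.
  move=> g1 g2 g3.
  exact: (product_relation Dp1 Dp2 sq1 sq2 sq3 sq4 (or_introl (conj erefl (conj erefl erefl))) g1 g2 g3 erefl).
have rel43 P : gen_cls (Ok p1 p2) P H1 -> gen_cls (Ok p1 p2) P H2 ->
    gen_cls (Ok p1 p2) P H4 -> gen_cls (Ok p1 p2) P H3.
  move=> g1 g2 g4.
  exact: (product_relation Dp1 Dp2 sq1 sq2 sq3 sq4 (or_intror (conj erefl (conj erefl erefl))) g1 g2 g4 erefl).
split=> [qn | qn]; last split=> ind.
- have [//||x [y [De Exy]]] := @quad_unit_int p1 p2 eps3 (-1) pr1 pr2 ne12 odd1 odd2 _ Ue.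
    by rewrite mulrN1z.
  have qk z : quad_field (2 * p1 * p2) z -> kfield p1 p2 z.
    by apply: gen_field_trans => // t; rewrite inE => /eqP ->; exact: k_sk.
  have [f' [h' [u [b [Hf Hh Uu Fb Db]]]]] :=
    norm_m1_relation sF Fi pr1 pr2 Dp1 Dp2 odd1 odd2 (ext_unit_group qk Ue) De Exy.
  set gens := (fun J => _).
  have g0 : gen_cls (Ok p1 p2) gens H0 by apply: gen_cls_mem => //; constructor 1.
  have g1 : gen_cls (Ok p1 p2) gens H1 by apply: gen_cls_mem => //; constructor 2.
  have g2 : gen_cls (Ok p1 p2) gens H2 by apply: gen_cls_mem => //; constructor 3.
  (* Either prime above p1 belongs to a listed generator, so the signs in the relation do not
     matter: it yields one of H3, H4, and the product relation yields the other. *)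
  have [Ha [ga sa]] : exists Ha, gen_cls (Ok p1 p2) gens Ha /\ sqrt_ideal (kfield p1 p2) (gauss e f') Ha.
    by case: Hf => ->; [exists H1 | exists H2].
  have gH H : sqrt_ideal (kfield p1 p2) (gauss g h') H -> gen_cls (Ok p1 p2) gens H.
    move=> sH; apply: (gen_cls_sqrt sF sH (sqrt_ideal_mul sF sq0 sa) (gen_cls_mul sF g0 ga) Uu Fb).
    by rewrite Db; ring.
  have [g3 g4] : gen_cls (Ok p1 p2) gens H3 /\ gen_cls (Ok p1 p2) gens H4.
    case: Hh => Dh; rewrite Dh in gH.
      by have g3 := gH _ sq3; split=> //; apply: rel34.
    by have g4 := gH _ sq4; split=> //; apply: rel43.
  by apply: result => // J [] ->; [constructor 1 | constructor 2 | constructor 3].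
- set gens := (fun J => _).
  have g1 : gen_cls (Ok p1 p2) gens H1 by apply: gen_cls_mem => //; constructor 2.
  have g2 : gen_cls (Ok p1 p2) gens H2 by apply: gen_cls_mem => //; constructor 3.
  have g3 : gen_cls (Ok p1 p2) gens H3 by apply: gen_cls_mem => //; constructor 4.
  apply: result => //; last exact: rel34.
  by apply: gen_cls_mem => //; constructor 1.
- have [//|//|x [y [De Exy]]] := @quad_unit_int p1 p2 eps3 1 pr1 pr2 ne12 odd1 odd2 _ Ue.
  have [u [b [Uu Fb Db]]] :=
    norm_1_relation sF Fi (@k_sk p1 p2) pr1 pr2 ne12 odd1 odd2 fund ind De Exy.
  set gens := (fun J => _).
  have g1 : gen_cls (Ok p1 p2) gens H1 by apply: gen_cls_mem => //; constructor 2.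
  have g3 : gen_cls (Ok p1 p2) gens H3 by apply: gen_cls_mem => //; constructor 3.
  have g2 : gen_cls (Ok p1 p2) gens H2.
    (* As p1 = pi_1 pi_2, a square equal to a unit times p1 makes H1 H2 principal. *)
    apply: (gen_cls_sqrt sF sq2 sq1 g1 Uu Fb).
    by rewrite Db -(gauss_mul_conj Dp1); ring.
  apply: result => //; last exact: rel34.
    by move=> J [] ->; [constructor 1 | constructor 2 | constructor 4].
  by apply: gen_cls_mem => //; constructor 1.
Qed.
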